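(* Let $\mu$ be a quasi-infinitely divisible distribution concentrated on $\mathbb Z$ with quasi-Lévy measure $\nu$, and let $h:\mathbb Z\to[0,\infty)$ be a function which is submultiplicative, i.e. there is $B>0$ with $h(n+m)\le B\,h(n)h(m)$ for all $n,m\in\mathbb Z$, and which satisfies the Gelfand–Raikov–Shilov (GRS) condition $\lim_{n\to\pm\infty}\frac{\log h(n)}{n}=0$. Then the following are equivalent: (i) $\mu$ has finite $h$-moment, i.e. $\int h(x)\,\mu(\mathrm dx)=\sum_{n\in\mathbb Z}h(n)\,\mu(\{n\})<\infty$. (ii) $\nu^+$ has finite $h$-moment, i.e. $\int h(x)\,\nu^+(\mathrm dx)=\sum_{n\in\mathbb Z}h(n)\,\nu^+(\{n\})<\infty$. (iii) $|\nu|$ has finite $h$-moment, i.e. $\int h(x)\,|\nu|(\mathrm dx)=\sum_{n\in\mathbb Z}h(n)\,|\nu|(\{n\})<\infty$.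
   Context: A representation function is a bounded Borel measurable function $c:\mathbb R\to\mathbb R$ with $\lim_{x\to0}(c(x)-x)/x^2=0$. Put $g_c(x,z)=(\mathrm e^{\mathrm i zx}-1-\mathrm i zc(x))/(1\wedge x^2)$ for $x\ne0$ and $g_c(0,z)=-z^2/2$. A probability distribution $\mu$ on $\mathbb R$ is quasi-infinitely divisible if, for a fixed representation function $c$, there are $\gamma\in\mathbb R$ and a finite signed Borel measure $\zeta$ on $\mathbb R$ with $\widehat\mu(z)=\int\mathrm e^{\mathrm i zx}\mu(\mathrm dx)=\exp(\mathrm i\gamma z+\int_{\mathbb R}g_c(x,z)\,\zeta(\mathrm dx))$ for all $z\in\mathbb R$. (This property does not depend on $c$; for given $c$ the pair $(\zeta,\gamma)$ is unique, and $\zeta$ does not depend on $c$.) The quasi-Lévy measure of $\mu$ is $\nu(B)=\int_B(1\wedge x^2)^{-1}\zeta(\mathrm dx)$ for Borel sets $B$ bounded away from $0$. For a quasi-infinitely divisible distribution concentrated on $\mathbb Z$ it is known that $\nu$ extends (with $\nu(\{0\})=0$) to a finite signed measure concentrated on $\mathbb Z$. $|\nu|$ and $\nu^+$ are its total variation and positive part (Jordan decomposition). *)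

(* Defs.v *)
From HB Require Import structures.
From mathcomp Require Import all_boot all_order all_algebra.
From mathcomp Require Import all_classical all_reals all_analysis.
From mathcomp Require Export complex.

Set Implicit Arguments.
Unset Strict Implicit.
Unset Printing Implicit Defensive.

Import Order.TTheory GRing.Theory Num.Theory.
Import numFieldNormedType.Exports.

Local Open Scope classical_set_scope.
Local Open Scope ring_scope.
Local Open Scope complex_scope.

Section measure_integral.
Context d (T : measurableType d) (R : realType).

Definition measure_cintegral (mu : {measure set T -> \bar R}) (f : T -> R[i])
    : R[i] :=
  (\int[mu]_x complex.Re (f x)) +i* (\int[mu]_x complex.Im (f x)).

End measure_integral.

(* Any two Hahn decompositions of [nu] differ by a [nu]-null set, hence the
   Jordan decomposition below does not depend on the one chosen here. *)
Section charge_integral.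
Context d (T : measurableType d) (R : realType).
Variable nu : {charge set T -> \bar R}.

Definition hahn_pos : set T := projT1 (cid (Hahn_decomposition nu)).

Definition hahn_neg : set T := projT1 (cid (projT2 (cid (Hahn_decomposition nu)))).

Definition hahnP : hahn_decomposition nu hahn_pos hahn_neg :=
  projT2 (cid (projT2 (cid (Hahn_decomposition nu)))).

Definition jordan_pos_part : {measure set T -> \bar R} := jordan_pos hahnP.

Definition jordan_neg_part : {measure set T -> \bar R} := jordan_neg hahnP.

Definition charge_total_variation : set T -> \bar R := charge_variation hahnP.

Definition charge_integral (D : set T) (f : T -> R) : R :=
  \int[jordan_pos_part]_(x in D) f x - \int[jordan_neg_part]_(x in D) f x.

Definition charge_cintegral (f : T -> R[i]) : R[i] :=
  charge_integral setT (fun x => complex.Re (f x)) +i*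
  charge_integral setT (fun x => complex.Im (f x)).

End charge_integral.

Section quasi_infinitely_divisible.
Context (R : realType).
Local Notation RT := (measurableTypeR R).

Definition cexp (w : R[i]) : R[i] :=
  (expR (complex.Re w) * cos (complex.Im w)) +i*
  (expR (complex.Re w) * sin (complex.Im w)).

Definition charfun (mu : probability RT R) (z : R) : R[i] :=
  measure_cintegral mu (fun x => cexp ('i%C * (z * x)%:C)).

Definition representation_function (c : R -> R) : Prop :=
  [/\ measurable_fun setT (c : RT -> RT),
      exists M : R, forall x, `|c x| <= M &
      (c x - x) / x ^+ 2 @[x --> 0^'] --> 0].

Definition gker (c : R -> R) (x z : R) : R[i] :=
  if x == 0 then (- (z ^+ 2 / 2))%:C
  else (cexp ('i%C * (z * x)%:C) - 1 - 'i%C * (z * c x)%:C)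
         / (Num.min 1 (x ^+ 2))%:C.

Definition characteristic_pair (c : R -> R) (mu : probability RT R)
    (zeta : {charge set RT -> \bar R}) (gamma : R) : Prop :=
  forall z : R, charfun mu z =
    cexp ('i%C * (gamma * z)%:C + charge_cintegral zeta (fun x => gker c x z)).

Definition quasi_infinitely_divisible (c : R -> R) (mu : probability RT R)
    : Prop :=
  exists (gamma : R) (zeta : {charge set RT -> \bar R}),
    characteristic_pair c mu zeta gamma.

Definition bounded_away_from0 (B : set R) : Prop :=
  exists2 e : R, 0 < e & forall x, B x -> e <= `|x|.

(* A [{charge set _ -> _}] takes finite values only: [nu] is the extension, as
   a finite signed measure without mass at 0, of the set function
   B |-> \int_B (1 /\ x^2)^-1 zeta(dx), which is a priori defined only for
   B bounded away from 0. *)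
Definition quasi_levy_measure (c : R -> R) (mu : probability RT R)
    (nu : {charge set RT -> \bar R}) : Prop :=
  exists (gamma : R) (zeta : {charge set RT -> \bar R}),
    [/\ characteristic_pair c mu zeta gamma,
        nu [set 0] = 0%E &
        forall B : set RT, measurable B -> bounded_away_from0 B ->
          nu B = (charge_integral zeta B
                    (fun x => (Num.min 1 (x ^+ 2))^-1))%:E].

Definition integers : set R := range (fun n : int => n%:~R).

Definition concentrated_on_integers (mu : probability RT R) : Prop :=
  mu integers = 1%E.

Definition submultiplicative (h : int -> R) : Prop :=
  exists2 B : R, 0 < B & forall n m : int, h (n + m) <= B * h n * h m.

(* The extended logarithm has [lne 0 = -oo], whereas [ln 0 = 0]. *)
Definition log_ratio (h : int -> R) (n : int) : \bar R :=
  (lne (h n)%:E * (n%:~R^-1)%:E)%E.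

Definition GRS_condition (h : int -> R) : Prop :=
  log_ratio h n%:Z @[n --> \oo] --> 0%E /\
  log_ratio h (- n%:Z) @[n --> \oo] --> 0%E.

(* [h] is defined on the integers only: this is the integral of [h] against [m]
   for [m] concentrated on the integers. *)
Definition moment (h : int -> R) (m : set RT -> \bar R) : \bar R :=
  (\esum_(n in [set: int]) ((h n)%:E * m [set n%:~R]))%E.

Definition finite_moment (h : int -> R) (m : set RT -> \bar R) : Prop :=
  (moment h m < +oo)%E.

End quasi_infinitely_divisible.

(* Main.v *)
Require Import Defs.
From mathcomp Require Import all_boot all_order all_algebra.
From mathcomp Require Import all_classical all_reals all_analysis.
From mathcomp Require Import ring lra zify measurable_realfun.

Set Implicit Arguments.
Unset Strict Implicit.
Unset Printing Implicit Defensive.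

Import Order.TTheory GRing.Theory Num.Theory.
Import numFieldNormedType.Exports.

(** Write [e_n(z) = exp(i n z)] and let [p], [q] be the positive and the negative
    part of [nu]. Everything rests on the identity of functions of [z]
<<
      mu^(z) = C e_k(z) exp(p^(z) - q^(z)),   C > 0 and k an integer,
>>
    where the transforms on the right only see the point masses of [p] and [q]
    at the integers ([int_transform_exp]). To obtain it, rewrite the exponent
    of the quasi-Levy representation as
    [i g z - s z^2 / 2 + nu^(z) - nu^(0)] with [s = zeta{0}]
    ([quasi_levy_integral]). Since [mu] lives on the integers, [mu^] has period
    [2 pi]. The modulus of [mu^] forces [s = 0]; the increment of the exponent
    over a period is continuous and lies in [2 pi i Z], hence is constant, and the
    boundedness of [nu^] then makes [g] an integer and [nu^] periodic; averaging
    [nu^] over [z + 2 pi j], [j < J], and letting [J] tend to infinity removes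
    all the mass of [nu] off the integers.

    Replace [h] by the equivalent weight [H], equal to 1 at 0 and to
    [max (B h) 1] elsewhere: [H >= 1] and [H (n + m) <= H n * H m]. Sequences
    summable against [H] are the coefficients of a Banach algebra of functions.
    It is handled without completeness or convolutions: [wiener_ball] says that a
    function is a uniform limit of trigonometric polynomials whose [H]-norms are
    at most [K]. This is stable under products and exponentials, and the
    coefficients [fcoef] of such a function are well defined and summable against
    [H], because a coefficient of a trigonometric polynomial is an average of its
    values.

    A finite moment of [nu^+] gives one of [mu] ([moment_of_pos_part]): in
    [mu^ exp(q^) = C e_k exp(p^)] the right side lies in the algebra, and the left
    side dominates [mu^] coefficientwise as [exp(q^) - 1] has nonnegative
    coefficients.

    A finite moment of [mu] gives one of [|nu|] ([total_variation_moment]), since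
    [exp(nu^)] lies in the algebra of [H] and, by the weighted Wiener-Levy theorem
    [wiener_levy_log], so does the logarithm [nu^]. After subtraction of a
    trigonometric polynomial one has to treat [r] of small norm for the weight 1
    with [exp r] in the algebra of [H]. This is where the GRS condition enters:
    [H] is subexponential, so it is equivalent to a weight [w] that is nearly 1 on
    any prescribed window ([weight_flatten]); choosing the window to contain most
    of the mass of [exp r - 1] makes [exp r - 1] small for [w], and a
    continuity argument along the bounded weights [min w 2^j] shows that [r] is
    small for [w] too ([small_log]). *)

Local Open Scope classical_set_scope.
Local Open Scope ring_scope.
Local Open Scope complex_scope.


(** * The complex modulus and the complex exponential *)

Section modulus.
Variable R : realType.
Implicit Types (x y : R[i]).

Definition cmod (x : R[i]) : R := ComplexField.Normc.normc x.

Lemma cmodM x y : cmod (x * y) = cmod x * cmod y.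
Proof. exact: ComplexField.Normc.normcM. Qed.

Lemma cmodD x y : cmod (x + y) <= cmod x + cmod y.
Proof. exact: le_normcD. Qed.

Lemma cmodN x : cmod (- x) = cmod x.
Proof. exact: normcN. Qed.

Lemma cmodB x y : cmod (x - y) <= cmod x + cmod y.
Proof. by rewrite -(cmodN y) cmodD. Qed.

Lemma cmod_dist x y : cmod (x - y) = cmod (y - x).
Proof. by rewrite -cmodN opprB. Qed.

Lemma cmod0 : cmod 0 = 0. Proof. exact: ComplexField.Normc.normc0. Qed.

Lemma cmod1 : cmod 1 = 1. Proof. exact: ComplexField.Normc.normc1. Qed.

Lemma cmod_ge0 x : 0 <= cmod x.
Proof. by case: x => a b; exact: sqrtr_ge0. Qed.

Lemma cmodR (a : R) : cmod a%:C = `|a|.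
Proof. by rewrite /cmod /= expr0n /= addr0 sqrtr_sqr. Qed.

Lemma cmodX x n : cmod (x ^+ n) = cmod x ^+ n.
Proof. by elim: n => [|n IH]; rewrite ?cmod1 // !exprS cmodM IH. Qed.

Lemma cmod_sum (I : Type) (s : seq I) (P : pred I) (F : I -> R[i]) :
  cmod (\sum_(i <- s | P i) F i) <= \sum_(i <- s | P i) cmod (F i).
Proof.
elim/big_ind2 : _ => [|x a y b Ha Hb|//]; first by rewrite cmod0.
by rewrite (le_trans (cmodD _ _)) // lerD.
Qed.

Lemma Re_le_cmod x : `|complex.Re x| <= cmod x.
Proof.
case: x => a b /=; rewrite -sqrtr_sqr ler_wsqrtr // lerDl; exact: sqr_ge0.
Qed.

Lemma Im_le_cmod x : `|complex.Im x| <= cmod x.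
Proof.
case: x => a b /=; rewrite -sqrtr_sqr ler_wsqrtr // lerDr; exact: sqr_ge0.
Qed.

Lemma cmod_le_ReIm x : cmod x <= `|complex.Re x| + `|complex.Im x|.
Proof.
case: x => a b.
have -> : a +i* b = a%:C + 'i%C * b%:C by simpc.
rewrite (le_trans (cmodD _ _)) // cmodM !cmodR /cmod /=.
by rewrite !expr0n !expr1n /= !(addr0, add0r, mulr0, mul0r, subr0, sqrtr1, mul1r, mulr1).
Qed.

Lemma cReM x y : complex.Re (x * y) =
  complex.Re x * complex.Re y - complex.Im x * complex.Im y.
Proof. by case: x; case: y. Qed.

Lemma cImM x y : complex.Im (x * y) =
  complex.Re x * complex.Im y + complex.Im x * complex.Re y.
Proof. by case: x; case: y. Qed.

Lemma cReD x y : complex.Re (x + y) = complex.Re x + complex.Re y.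
Proof. by case: x; case: y. Qed.

Lemma cImD x y : complex.Im (x + y) = complex.Im x + complex.Im y.
Proof. by case: x; case: y. Qed.

Lemma cReN x : complex.Re (- x) = - complex.Re x.
Proof. by case: x. Qed.

Lemma cImN x : complex.Im (- x) = - complex.Im x.
Proof. by case: x. Qed.

Lemma complex_ext x y : complex.Re x = complex.Re y ->
  complex.Im x = complex.Im y -> x = y.
Proof. by case: x; case: y => a b c d /= -> ->. Qed.

End modulus.

Section exp_partial_sum.

Definition exp_sum (F : fieldType) (N : nat) (x : F) : F :=
  \sum_(0 <= k < N) x ^+ k / k`!%:R.

(** The Cauchy product, in the form of the two ways to sum over a triangle. *)
Lemma sum_triangle (V : zmodType) (f : nat -> nat -> V) (N : nat) :
  \sum_(0 <= j < N) \sum_(0 <= l < N - j) f j l =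
  \sum_(0 <= k < N) \sum_(0 <= j < k.+1) f j (k - j)%N.
Proof.
elim: N => [|N IH]; first by rewrite !big_geq.
rewrite big_nat_recr //= subSnn big_nat1 [RHS]big_nat_recr //= -IH.
rewrite [X in _ = _ + X]big_nat_recr //= subnn addrA -big_split /=.
congr (_ + _); apply: eq_big_nat => j /andP[_ jN].
by rewrite subSn 1?ltnW // big_nat_recr.
Qed.

(** What the product of two partial sums has in excess of the partial sum at
    [x + y] is made of the products of terms outside the triangle; applied to
    absolute values it bounds itself, and this is how the error is estimated in
    [cexp_sum_cvg]. *)
Lemma exp_sum_prod (F : numFieldType) (N : nat) (x y : F) :
  exp_sum N x * exp_sum N y = exp_sum N (x + y) +
    \sum_(0 <= j < N) \sum_(N - j <= l < N)
      (x ^+ j / j`!%:R) * (y ^+ l / l`!%:R).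
Proof.
have -> : exp_sum N (x + y) = \sum_(0 <= j < N) \sum_(0 <= l < N - j)
    (x ^+ j / j`!%:R) * (y ^+ l / l`!%:R).
  rewrite sum_triangle; apply: eq_big_nat => k _.
  rewrite addrC exprDn mulr_suml big_mkord; apply: eq_bigr => -[j /= jk] _.
  have kj : (j <= k)%N by [].
  rewrite -mulr_natr -(bin_fact kj) !natrM.
  have nz n : (n`!%:R != 0 :> F) by rewrite pnatr_eq0 -lt0n fact_gt0.
  have bz : 'C(k, j)%:R != 0 :> F by rewrite pnatr_eq0 -lt0n bin_gt0.
  field; by rewrite !nz bz.
rewrite -big_split /= mulr_suml; apply: eq_big_nat => j /andP[_ jN].
by rewrite mulr_sumr (@big_cat_nat _ _ _ (N - j)) // leq_subr.
Qed.

End exp_partial_sum.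

Section complex_exponential.
Variable R : realType.
Implicit Types (x y m : R) (w : R[i]).

Lemma exp_sum_cvg x : exp_sum N x @[N --> \oo] --> expR x.
Proof. exact: is_cvg_series_exp_coeff. Qed.

Lemma exp_sum_mono N M x : 0 <= x -> (N <= M)%N -> exp_sum N x <= exp_sum M x.
Proof.
move=> x0 NM; rewrite /exp_sum [leRHS](@big_cat_nat _ _ _ N) //= lerDl.
by apply: sumr_ge0 => i _; rewrite divr_ge0 // exprn_ge0.
Qed.

Lemma exp_sum_le_expR N x : 0 <= x -> exp_sum N x <= expR x.
Proof.
move=> x0; apply: nondecreasing_cvgn_le; last exact: is_cvg_series_exp_coeff.
by move=> n m nm; exact: exp_sum_mono.
Qed.

Lemma cmod_exp_term w k : cmod (w ^+ k / k`!%:R) = cmod w ^+ k / k`!%:R.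
Proof.
rewrite cmodM cmodX; congr (_ * _).
rewrite (_ : _^-1 = (k`!%:R^-1 : R)%:C); last by rewrite fmorphV rmorph_nat.
by rewrite cmodR ger0_norm // invr_ge0.
Qed.

Lemma exp_sum_tail N M w m : cmod w <= m -> (N <= M)%N ->
  cmod (exp_sum M w - exp_sum N w) <= exp_sum M m - exp_sum N m.
Proof.
move=> wm NM; rewrite /exp_sum !(@big_cat_nat _ _ _ N 0 M) //=.
rewrite [_ + _ - _]addrAC subrr add0r [_ + _ - _]addrAC subrr add0r.
rewrite (le_trans (cmod_sum _ _ _)) //; apply: ler_sum => k _.
rewrite cmod_exp_term ler_wpM2r ?invr_ge0 //.
by rewrite lerXn2r // nnegrE ?cmod_ge0 // (le_trans (cmod_ge0 w)).
Qed.

Lemma exp_sum_im N y :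
  exp_sum N ('i%C * y%:C) = series (cos_coeff y) N +i* series (sin_coeff y) N.
Proof.
rewrite /exp_sum /series /=; elim: N => [|N IH]; first by rewrite !big_geq.
rewrite !big_nat_recr //= IH.
suff -> : ('i * y%:C) ^+ N / N`!%:R = cos_coeff y N +i* sin_coeff y N by [].
rewrite exprMn -rmorphXn /= (_ : _^-1 = (N`!%:R^-1 : R)%:C); last first.
  by rewrite fmorphV rmorph_nat.
have iE : 'i%C ^+ N = ((~~ odd N)%:R * (-1) ^+ N./2) +i*
                   ((odd N)%:R * (-1) ^+ N.-1./2) :> R[i].
  rewrite -{1}(odd_double_half N) exprD -mul2n exprM sqr_i.
  have -> : (-1 : R[i]) ^+ N./2 = ((-1) ^+ N./2)%:C by rewrite rmorphXn rmorphN1.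
  case: (boolP (odd N)) => oN /=; rewrite ?expr1 ?expr0.
    have -> : N.-1./2 = N./2 by rewrite -{1}(odd_double_half N) oN /= doubleK.
    by simpc.
  by simpc.
rewrite iE /cos_coeff /sin_coeff; apply: complex_ext; rewrite !(cReM, cImM) /=. all: by rewrite !(mulr0, subr0, add0r, addr0).

Qed.

(** [cexp] is defined by real exponential, cosine and sine; its power series
    comes from theirs, multiplied at [w = x + i y]. *)
Lemma cexp_sum_cvg w e : 0 < e ->
  \forall N \near \oo, cmod (cexp w - exp_sum N w) <= e.
Proof.
case: w => x y e0.
pose X N := exp_sum N x.
pose P N := expR x * cos y - X N * series (cos_coeff y) N.
pose Q N := expR x * sin y - X N * series (sin_coeff y) N.
pose S N := exp_sum N `|x| * exp_sum N `|y| - exp_sum N (`|x| + `|y|).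
have cX := exp_sum_cvg (x := x).
have P0 : P N @[N --> \oo] --> 0.
  rewrite -(subrr (expR x * cos y)); apply: cvgB; first exact: cvg_cst.
  by apply: cvgM => //; rewrite unlock; exact: is_cvg_series_cos_coeff.
have Q0 : Q N @[N --> \oo] --> 0.
  rewrite -(subrr (expR x * sin y)); apply: cvgB; first exact: cvg_cst.
  by apply: cvgM => //; rewrite unlock; exact: is_cvg_series_sin_coeff.
have S0 : S N @[N --> \oo] --> 0.
  rewrite -(subrr (expR (`|x| + `|y|))); apply: cvgB; last exact: exp_sum_cvg.
  by rewrite expRD; apply: cvgM; exact: exp_sum_cvg.
have : `|P N| + `|Q N| + S N @[N --> \oo] --> 0.
  rewrite -(addr0 (0 : R)) -{1}(addr0 (0 : R)); apply: cvgD => //.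
  by apply: cvgD; [move/cvg_norm : P0 | move/cvg_norm : Q0]; rewrite normr0.
move/cvgrPdist_le => /(_ _ e0); apply: filterS => N.
rewrite sub0r normrN => H; apply: le_trans (le_trans (ler_norm _) H).
have wE : (x +i* y) = x%:C + 'i%C * y%:C by simpc.
rewrite -[cexp _ - _](subrKA (exp_sum N x%:C * exp_sum N ('i%C * y%:C))).
rewrite (le_trans (cmodD _ _)) // lerD //.
  rewrite (le_trans (cmod_le_ReIm _)) // /cexp exp_sum_im.
  have -> : exp_sum N x%:C = (X N)%:C.
    rewrite /X /exp_sum rmorph_sum; apply: eq_bigr => k _.
    by rewrite rmorphM rmorphXn fmorphV rmorph_nat.
  by rewrite /= !(mul0r, subr0, addr0).
rewrite wE exp_sum_prod addrAC subrr add0r /S exp_sum_prod addrAC subrr add0r.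
rewrite (le_trans (cmod_sum _ _ _)) //; apply: ler_sum => j _.
rewrite (le_trans (cmod_sum _ _ _)) //; apply: ler_sum => l _.
rewrite cmodM !cmod_exp_term cmodM !cmodR.
have -> : cmod ('i%C : R[i]) = 1.
  by rewrite /cmod /= expr0n expr1n add0r sqrtr1.
by rewrite mul1r.
Qed.

(** The remainder of the exponential series is dominated by its value at a
    bound of the modulus, uniformly in the argument. *)
Lemma cexp_exp_sum N w m : cmod w <= m ->
  cmod (cexp w - exp_sum N w) <= expR m - exp_sum N m.
Proof.
move=> wm; apply/ler_addgt0Pr => e e0.
have m0 : 0 <= m by exact: le_trans (cmod_ge0 w) wm.
near \oo => M.
rewrite -[cexp w - _](subrKA (exp_sum M w)) addrC (le_trans (cmodD _ _)) //.
apply: lerD; last by near: M; exact: cexp_sum_cvg.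
rewrite (le_trans (exp_sum_tail wm _)) //; first by near: M; exact: nbhs_infty_ge.
by rewrite lerD2r exp_sum_le_expR.
Unshelve. all: by end_near. Qed.

Lemma cexpD (v w : R[i]) : cexp (v + w) = cexp v * cexp w.
Proof.
case: v => a b; case: w => c d; rewrite /cexp /= expRD cosD sinD.
by simpc; apply: complex_ext => /=; ring.
Qed.

Lemma cexp0 : cexp 0 = 1 :> R[i].
Proof. by rewrite /cexp /= expR0 cos0 sin0 mulr1 mulr0. Qed.

Lemma cmod_cexp w : cmod (cexp w) = expR (complex.Re w).
Proof.
case: w => a b; rewrite /cexp /cmod /= !exprMn -mulrDr cos2Dsin2 mulr1.
by rewrite sqrtr_sqr ger0_norm // expR_ge0.
Qed.

End complex_exponential.

(** * Trigonometric polynomials and extraction of their coefficients *)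

Section circle.
Variable R : realType.
Implicit Types (x z : R) (n k : int).

Definition unit_cexp x : R[i] := cexp ('i%C * x%:C).

Lemma unit_cexpE x : unit_cexp x = cos x +i* sin x.
Proof. by rewrite /unit_cexp; simpc; rewrite /cexp /= expR0 !mul1r. Qed.

Lemma unit_cexpD x y : unit_cexp (x + y) = unit_cexp x * unit_cexp y.
Proof. by rewrite /unit_cexp rmorphD mulrDr cexpD. Qed.

Lemma unit_cexp0 : unit_cexp 0 = 1.
Proof. by rewrite /unit_cexp mulr0 cexp0. Qed.

Lemma cmod_unit_cexp x : cmod (unit_cexp x) = 1.
Proof. by rewrite cmod_cexp; simpc; rewrite expR0. Qed.

Lemma unit_cexp_mulrn x j : unit_cexp (x *+ j) = unit_cexp x ^+ j.
Proof.
by elim: j => [|j IH]; rewrite ?unit_cexp0 // mulrS unit_cexpD IH exprS.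
Qed.

Lemma unit_cexp_2pi_nat j : unit_cexp (2 * pi * j%:R) = 1.
Proof.
rewrite mulr_natr unit_cexp_mulrn unit_cexpE mulr_natl cos2pi sin2pi.
exact: expr1n.
Qed.

Lemma unit_cexp_2pi k : unit_cexp (2 * pi * k%:~R) = 1.
Proof.
case: k => j; first exact: unit_cexp_2pi_nat.
have := unit_cexpD (2 * pi * (Negz j)%:~R) (2 * pi * j.+1%:R).
by rewrite unit_cexp_2pi_nat mulr1 => <-; rewrite NegzE rmorphN mulrN addNr unit_cexp0.
Qed.

(** For the fractional part [t] of [x], [cos (2 pi t) = 1] gives
    [sin (pi t) = 0], which fails inside [(0, 1)]. *)
Lemma unit_cexp_2pi_eq1 x : unit_cexp (2 * pi * x) = 1 ->
  exists k : int, x = k%:~R.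
Proof.
move=> x1; exists (Num.floor x).
pose t := x - (Num.floor x)%:~R.
have t0 : 0 <= t by rewrite subr_ge0; exact: Num.Theory.floor_le.
have t1 : t < 1.
  by rewrite ltrBlDl -[X in _ < _ + X](mulr1z 1) -rmorphD /= floorD1_gt.
have : unit_cexp (2 * pi * t) = 1.
  have := unit_cexpD (2 * pi * t) (2 * pi * (Num.floor x)%:~R).
  by rewrite unit_cexp_2pi mulr1 -mulrDr subrK x1.
move/(congr1 (@complex.Re R)); rewrite unit_cexpE /= => c1.
have [t00|tn0] := eqVneq t 0; first by apply/eqP; rewrite -subr_eq0 -/t t00.
have tp : 0 < t by rewrite lt_neqAle eq_sym tn0.
have : 0 < sin (pi * t).
  apply: sin_gt0_pi; rewrite mulr_gt0 ?pi_gt0 //=.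
  by rewrite gtr_pMr ?pi_gt0.
have -> // : sin (pi * t) = 0.
  have := cosD (pi * t) (pi * t); have := cos2Dsin2 (pi * t).
  rewrite (_ : pi * t + pi * t = 2 * pi * t); last by ring.
  rewrite c1 => H1 H2.
  by apply/eqP; rewrite -sqrf_eq0; apply/eqP; lra.
by rewrite ltxx.
Qed.

Lemma geometric_sum_le (q : R[i]) (J : nat) : cmod q = 1 ->
  cmod (\sum_(0 <= j < J) q ^+ j) * cmod (q - 1) <= 2.
Proof.
move=> q1; rewrite -cmodM mulrC big_mkord -subrX1.
by rewrite (le_trans (cmodB _ _)) // cmod1 cmodX q1 expr1n.
Qed.

(** The character of the circle with frequency [n]. *)
Definition tone n z : R[i] := unit_cexp (z * n%:~R).

Lemma toneD n k z : tone (n + k) z = tone n z * tone k z.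
Proof. by rewrite /tone rmorphD mulrDr unit_cexpD. Qed.

Lemma tone0 z : tone 0 z = 1.
Proof. by rewrite /tone mulr0 unit_cexp0. Qed.

Lemma cmod_tone n z : cmod (tone n z) = 1.
Proof. exact: cmod_unit_cexp. Qed.

(** Averaging over the [M]-th roots of unity kills every character that is not
    trivial on them. *)
Lemma sum_tone_roots (M : nat) k : (`|k| < M)%N ->
  \sum_(0 <= j < M) tone k (2 * pi * j%:R / M%:R) = if k == 0 then M%:R else 0.
Proof.
move=> kM; have M0 : M%:R != 0 :> R by rewrite pnatr_eq0; lia.
have [->|k0] := eqVneq k 0.
  under eq_bigr do rewrite tone0.
  by rewrite big_const_nat subn0 iter_addr_0.
pose q := unit_cexp (2 * pi * (k%:~R / M%:R)).
have qE j : tone k (2 * pi * j%:R / M%:R) = q ^+ j.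
  by rewrite -unit_cexp_mulrn /tone -mulr_natr; congr unit_cexp; field.
under eq_bigr do rewrite qE.
have qM : q ^+ M = 1.
  rewrite -unit_cexp_mulrn -mulr_natr -[RHS](unit_cexp_2pi k).
  by congr unit_cexp; field.
have q1 : q != 1.
  apply/eqP => /unit_cexp_2pi_eq1 [m /(congr1 (fun x => x * M%:R))].
  rewrite divfK // -[M%:R]/((M%:Z)%:~R) -rmorphM /= => /intr_inj kE.
  move: kM k0; rewrite kE abszM mulf_eq0 negb_or => kM /andP[m0 _].
  by move: kM; rewrite ltnNge leq_pmull // absz_gt0.
have := subrX1 q M; rewrite qM subrr => /esym/eqP.
by rewrite mulf_eq0 subr_eq0 (negbTE q1) /= big_mkord => /eqP.
Qed.

End circle.

Section trigonometric_polynomials.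
Variable R : realType.
Implicit Types (P Q : seq (R * int)) (z b : R) (n : int) (w : int -> R).

(** Trigonometric polynomials are lists of pairs (coefficient, frequency) in
    which a frequency may occur several times; products then need no
    regrouping, and norms are trivially submultiplicative. *)
Definition tpoly_eval P z : R[i] := \sum_(t <- P) t.1%:C * tone t.2 z.

Definition tpoly_norm w P : R := \sum_(t <- P) `|t.1| * w t.2.

Definition tpoly_coef P n : R := \sum_(t <- P | t.2 == n) t.1.

Definition tpoly_mul P Q : seq (R * int) :=
  [seq (s.1 * t.1, s.2 + t.2) | s <- P, t <- Q].

Definition tpoly_opp P : seq (R * int) := [seq (- t.1, t.2) | t <- P].

Lemma tpoly_eval_cat P Q z :
  tpoly_eval (P ++ Q) z = tpoly_eval P z + tpoly_eval Q z.
Proof. exact: big_cat. Qed.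

Lemma tpoly_eval_opp P z : tpoly_eval (tpoly_opp P) z = - tpoly_eval P z.
Proof.
rewrite /tpoly_eval big_map -sumrN; apply: eq_bigr => t _ /=.
by rewrite rmorphN mulNr.
Qed.

Lemma tpoly_eval_mul P Q z :
  tpoly_eval (tpoly_mul P Q) z = tpoly_eval P z * tpoly_eval Q z.
Proof.
rewrite /tpoly_eval big_allpairs_dep mulr_suml; apply: eq_bigr => s _.
rewrite mulr_sumr; apply: eq_bigr => t _ /=.
by rewrite toneD rmorphM /= mulrACA.
Qed.

Lemma tpoly_coef_cat P Q n :
  tpoly_coef (P ++ Q) n = tpoly_coef P n + tpoly_coef Q n.
Proof. exact: big_cat. Qed.

Lemma tpoly_coef_opp P n : tpoly_coef (tpoly_opp P) n = - tpoly_coef P n.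
Proof. by rewrite /tpoly_coef big_map -sumrN. Qed.

Lemma tpoly_norm_cat w P Q :
  tpoly_norm w (P ++ Q) = tpoly_norm w P + tpoly_norm w Q.
Proof. exact: big_cat. Qed.

Lemma tpoly_norm_opp w P : tpoly_norm w (tpoly_opp P) = tpoly_norm w P.
Proof.
by rewrite /tpoly_norm big_map; apply: eq_bigr => t _ /=; rewrite normrN.
Qed.

Lemma tpoly_norm_mul w P Q : (forall n m, w (n + m) <= w n * w m) ->
  tpoly_norm w (tpoly_mul P Q) <= tpoly_norm w P * tpoly_norm w Q.
Proof.
move=> wM; rewrite /tpoly_norm big_allpairs_dep mulr_suml; apply: ler_sum => s _.
rewrite mulr_sumr; apply: ler_sum => t _ /=.
by rewrite normrM mulrACA ler_wpM2l ?mulr_ge0.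
Qed.

Lemma tpoly_norm_ge0 w P : (forall n, 1 <= w n) -> 0 <= tpoly_norm w P.
Proof.
by move=> w1; apply: sumr_ge0 => t _; rewrite mulr_ge0 // (le_trans ler01).
Qed.

Lemma cmod_tpoly_eval w P z : (forall n, 1 <= w n) ->
  cmod (tpoly_eval P z) <= tpoly_norm w P.
Proof.
move=> w1; rewrite (le_trans (cmod_sum _ _ _)) //; apply: ler_sum => t _.
by rewrite cmodM cmod_tone mulr1 cmodR ler_peMr.
Qed.

(** A coefficient is an average of values, taken over so many roots of unity
    that no two frequencies of the polynomial are confused. *)
Lemma tpoly_coef_le P n b : (forall z, cmod (tpoly_eval P z) <= b) ->
  `|tpoly_coef P n| <= b.
Proof.
move=> Pb; pose M := (\max_(t <- P) `|t.2 - n|%N).+1.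
have M0 : M%:R != 0 :> R by rewrite pnatr_eq0.
have Mgt t : t \in P -> (`|(t.2 - n)%R| < M)%N.
  by move=> tP; rewrite ltnS; exact: (@leq_bigmax_seq _ _ _ (fun t => `|t.2 - n|%N)).
pose zj (j : nat) : R := 2 * pi * j%:R / M%:R.
have : \sum_(0 <= j < M) tpoly_eval P (zj j) * tone (- n) (zj j) =
    (M%:R * tpoly_coef P n)%:C.
  under eq_bigr do rewrite mulr_suml.
  rewrite exchange_big /= mulr_sumr rmorph_sum /= [RHS]big_mkcond /=.
  rewrite [LHS]big_seq [RHS]big_seq.
  apply: eq_bigr => t tP.
  under eq_bigr do rewrite -mulrA -toneD.
  rewrite -mulr_sumr sum_tone_roots ?Mgt // subr_eq0.
  case: eqP => _; last by rewrite mulr0.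
  by rewrite rmorphM rmorph_nat mulrC.
move/(congr1 (@cmod R)); rewrite cmodR normrM normr_nat => H.
have Mp : 0 < M%:R :> R by rewrite ltr0n.
rewrite -(ler_pM2l Mp) -H (le_trans (cmod_sum _ _ _)) //.
apply: (@le_trans _ _ (\sum_(0 <= j < M) b)).
  by apply: ler_sum => j _; rewrite cmodM cmod_tone mulr1.
by rewrite big_const_nat subn0 iter_addr_0 mulr_natl.
Qed.

Lemma tpoly_coef_ge0 P n : all (fun t : R * int => 0 <= t.1) P -> 0 <= tpoly_coef P n.
Proof.
by move=> /allP P0; rewrite /tpoly_coef big_seq_cond sumr_ge0 // => t /andP[/P0].
Qed.

(** Collecting the terms of equal frequency can only decrease the norm. *)
Lemma tpoly_norm_coef w P (s : seq int) : (forall n, 0 <= w n) -> uniq s ->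
  \sum_(n <- s) `|tpoly_coef P n| * w n <= tpoly_norm w P.
Proof.
move=> w0 us.
apply: (@le_trans _ _ (\sum_(n <- s) \sum_(t <- P | t.2 == n) `|t.1| * w t.2)).
  apply: ler_sum => n _; rewrite (eq_bigr (fun t => `|t.1| * w n)); last first.
    by move=> t /eqP ->.
  by rewrite -mulr_suml ler_wpM2r // ler_norm_sum.
rewrite (exchange_big_dep xpredT) //=; apply: ler_sum => t _.
rewrite -big_filter; have : uniq [seq i <- s | t.2 == i] by exact: filter_uniq.
have : all (pred1 t.2) [seq i <- s | t.2 == i].
  by apply/allP => i; rewrite mem_filter eq_sym => /andP[].
case: [seq i <- s | t.2 == i] => [|a [|b l]] /=; first by rewrite big_nil mulr_ge0.
  by rewrite big_seq1.
by move=> /and3P[/eqP -> /eqP -> _]; rewrite inE eqxx.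
Qed.

End trigonometric_polynomials.

(** * Absolutely convergent Fourier series with respect to a weight *)

Section wiener_ball.
Variable R : realType.
Implicit Types (P Q : seq (R * int)) (z K L e : R) (n : int) (w : int -> R).
Implicit Types (F G : R -> R[i]) (b : bool).

Definition weight w : Prop :=
  [/\ w 0 = 1, forall n, 1 <= w n & forall n m, w (n + m) <= w n * w m].

Definition nonneg_coefs P : bool := all (fun t : R * int => 0 <= t.1) P.

(** The ball of radius [K] of the algebra of absolutely convergent Fourier series
    with weight [w], closed under uniform limits. The flag [b] restricts it to
    limits of polynomials with nonnegative coefficients, so that the stability
    lemmas serve for norms and for positivity at once. *)
Definition wiener_ball b w K F : Prop := forall e, 0 < e ->
  exists P, [/\ b ==> nonneg_coefs P, tpoly_norm w P <= K &
                forall z, cmod (F z - tpoly_eval P z) <= e].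

Lemma weight_ge0 w n : weight w -> 0 <= w n.
Proof. by case=> _ w1 _; exact: le_trans ler01 (w1 n). Qed.

Lemma wiener_ball_ge0 b w K F : weight w -> wiener_ball b w K F -> 0 <= K.
Proof.
case=> _ w1 _ /(_ 1 ltr01) [P [_ PK _]].
by rewrite (le_trans (tpoly_norm_ge0 _ w1) PK).
Qed.

Lemma cmod_wiener_ball b w K F z :
  weight w -> wiener_ball b w K F -> cmod (F z) <= K.
Proof.
case=> _ w1 _ FK; apply/ler_addgt0Pr => e e0; have [P [_ PK FP]] := FK _ e0.
rewrite -[F z](subrK (tpoly_eval P z)) (le_trans (cmodD _ _)) // addrC.
by rewrite lerD // (le_trans (cmod_tpoly_eval _ _ w1)).
Qed.

Lemma wiener_ball_le b w K L F :
  K <= L -> wiener_ball b w K F -> wiener_ball b w L F.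
Proof.
move=> KL FK e /FK [P [bP PK FP]]; exists P; split => //.
exact: le_trans PK KL.
Qed.

Lemma wiener_ball_lim b w K F :
  (forall e, 0 < e -> exists2 G, wiener_ball b w K G &
     forall z, cmod (F z - G z) <= e) -> wiener_ball b w K F.
Proof.
move=> H e e0; have e2 : 0 < e / 2 by rewrite divr_gt0.
have [G GK FG] := H _ e2; have [P [bP PK GP]] := GK _ e2.
exists P; split => // z; rewrite -(subrKA (G z)) (le_trans (cmodD _ _)) //.
by rewrite (splitr e) lerD.
Qed.

Lemma wiener_ballD b w K L F G : wiener_ball b w K F -> wiener_ball b w L G ->
  wiener_ball b w (K + L) (fun z => F z + G z).
Proof.
move=> FK GL e e0; have e2 : 0 < e / 2 by rewrite divr_gt0.
have [P [bP PK FP]] := FK _ e2; have [Q [bQ QL GQ]] := GL _ e2.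
exists (P ++ Q); split.
- by case: b bP bQ {FK GL} => //= bP bQ; rewrite /nonneg_coefs all_cat; apply/andP.
- by rewrite tpoly_norm_cat lerD.
- move=> z; rewrite tpoly_eval_cat opprD addrACA (le_trans (cmodD _ _)) //.
  by rewrite (splitr e) lerD.
Qed.

Lemma wiener_ballN w K F :
  wiener_ball false w K F -> wiener_ball false w K (fun z => - F z).
Proof.
move=> FK e /FK [P [_ PK FP]]; exists (tpoly_opp P); split => //.
  by rewrite tpoly_norm_opp.
by move=> z; rewrite tpoly_eval_opp -opprD cmodN.
Qed.

Lemma wiener_ballM b w K L F G : weight w ->
  wiener_ball b w K F -> wiener_ball b w L G ->
  wiener_ball b w (K * L) (fun z => F z * G z).
Proof.
move=> hw FK GL e e0; have [_ w1 wM] := hw.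
have K0 := wiener_ball_ge0 hw FK; have L0 := wiener_ball_ge0 hw GL.
have d0 : 0 < K + L + 1 by lra.
have e2 : 0 < e / (K + L + 1) by rewrite divr_gt0.
have [P [bP PK FP]] := FK _ e2; have [Q [bQ QL GQ]] := GL _ e2.
exists (tpoly_mul P Q); split.
- case: b bP bQ {FK GL} => //= /allP bP /allP bQ; apply/allP => t.
  by move=> /allpairsP [[s u] /= [/bP sP /bQ uQ ->]] /=; rewrite mulr_ge0.
- rewrite (le_trans (tpoly_norm_mul _ _ wM)) //.
  by rewrite ler_pM ?tpoly_norm_ge0.
- move=> z; rewrite tpoly_eval_mul.
  have -> : F z * G z - tpoly_eval P z * tpoly_eval Q z =
    F z * (G z - tpoly_eval Q z) + (F z - tpoly_eval P z) * tpoly_eval Q z.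
    by ring.
  rewrite (le_trans (cmodD _ _)) // !cmodM.
  apply: (@le_trans _ _ (K * (e / (K + L + 1)) + e / (K + L + 1) * L)).
    rewrite lerD // ler_pM ?cmod_ge0 //; first exact: cmod_wiener_ball FK.
    exact: le_trans (cmod_tpoly_eval _ _ w1) QL.
  have -> : K * (e / (K + L + 1)) + e / (K + L + 1) * L =
    e * ((K + L) / (K + L + 1)) by field; lra.
  by rewrite ler_piMr ?(ltW e0) // ler_pdivrMr // mul1r lerDl.
Qed.

Lemma wiener_ball_tpoly b w P : (b ==> nonneg_coefs P) ->
  wiener_ball b w (tpoly_norm w P) (tpoly_eval P).
Proof.
move=> bP e e0; exists P; split => // z.
by rewrite subrr cmod0 ltW.
Qed.

Lemma wiener_ball_tone b w n (a : R) : (b ==> (0 <= a)) ->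
  wiener_ball b w (`|a| * w n) (fun z => a%:C * tone n z).
Proof.
move=> ba; have := @wiener_ball_tpoly b w [:: (a, n)].
rewrite /= andbT => /(_ ba); rewrite /tpoly_norm big_seq1.
by congr wiener_ball; apply/funext => z; rewrite /tpoly_eval big_seq1.
Qed.

Lemma wiener_ball_cst b w (a : R) : weight w -> 0 <= a ->
  wiener_ball b w a (fun=> a%:C).
Proof.
move=> [w0 _ _] a0; have := @wiener_ball_tone b w 0 a.
rewrite a0 implybT ger0_norm // w0 mulr1 => /(_ isT).
by congr wiener_ball; apply/funext => z; rewrite tone0 mulr1.
Qed.

Lemma wiener_ballX b w K F k : weight w ->
  wiener_ball b w K F -> wiener_ball b w (K ^+ k) (fun z => F z ^+ k).
Proof.
move=> hw FK; elim: k => [|k IH]; first exact: (wiener_ball_cst b hw ler01).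
rewrite exprS; have := wiener_ballM hw FK IH.
by congr wiener_ball; apply/funext => z; rewrite exprS.
Qed.

Lemma wiener_ball_exp_sum b w K F m N : weight w -> (m <= N)%N ->
  wiener_ball b w K F ->
  wiener_ball b w (exp_sum N K - exp_sum m K)
    (fun z => exp_sum N (F z) - exp_sum m (F z)).
Proof.
move=> hw /subnKC <- FK; elim: (N - m)%N => [|d IH].
  rewrite addn0 subrr; have := wiener_ball_cst b hw (lexx 0).
  by congr wiener_ball; apply/funext => z; rewrite subrr.
rewrite addnS.
have k0 : 0 <= (m + d)`!%:R^-1 :> R by rewrite invr_ge0.
have := wiener_ballD IH
  (wiener_ballM hw (wiener_ballX (m + d) hw FK) (wiener_ball_cst b hw k0)).
congr wiener_ball.
  by rewrite /exp_sum [in RHS]big_nat_recr //= addrAC.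
apply/funext => z; rewrite /exp_sum [in RHS]big_nat_recr //= addrAC.
by rewrite fmorphV rmorph_nat.
Qed.

(** The exponential series without its first [m] terms has nonnegative
    coefficients, so it is at most its value at the norm. *)
Lemma wiener_ball_cexp b w K F m : weight w -> wiener_ball b w K F ->
  wiener_ball b w (expR K - exp_sum m K)
    (fun z => cexp (F z) - exp_sum m (F z)).
Proof.
move=> hw FK; have K0 := wiener_ball_ge0 hw FK.
apply: wiener_ball_lim => e e0.
near \oo => N.
have mN : (m <= N)%N by near: N; exact: nbhs_infty_ge.
exists (fun z => exp_sum N (F z) - exp_sum m (F z)).
  apply: wiener_ball_le (wiener_ball_exp_sum hw mN FK).
  by rewrite lerD2r exp_sum_le_expR.
move=> z; rewrite opprB addrA subrK.
rewrite (le_trans (cexp_exp_sum _ (cmod_wiener_ball z hw FK))) //.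
rewrite (le_trans (ler_norm _)) //.
near: N; by have /cvgrPdist_le := exp_sum_cvg (x := K); exact.
Unshelve. all: by end_near. Qed.

(** The coefficients of a uniform limit of trigonometric polynomials. Each
    [tpoly_coef P n - e] is a lower bound of the limit coefficient, and these
    bounds become sharp as [e] tends to 0; a supremum replaces the limit. *)
Definition fcoef F n : R := sup [set a | exists P e,
  (forall z, cmod (F z - tpoly_eval P z) <= e) /\ a = tpoly_coef P n - e].

(** By [tpoly_coef_le], approximations of the same function have nearby
    coefficients, so [tpoly_coef P n + e] is an upper bound. *)
Lemma fcoef_close F P e n : (forall z, cmod (F z - tpoly_eval P z) <= e) ->
  `|fcoef F n - tpoly_coef P n| <= e.
Proof.
move=> FP; rewrite /fcoef; set S := (X in sup X).
have Sub : ubound S (tpoly_coef P n + e).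
  move=> _ [Q [d [FQ ->]]]; rewrite lerBlDr -addrA -lerBlDl.
  rewrite -tpoly_coef_opp -tpoly_coef_cat (le_trans (ler_norm _)) //.
  apply: tpoly_coef_le => z; rewrite tpoly_eval_cat tpoly_eval_opp.
  rewrite -(subrKA (F z)) addrC (le_trans (cmodD _ _)) // lerD //.
  by rewrite cmod_dist.
have SP : S (tpoly_coef P n - e) by exists P, e.
rewrite ler_norml; apply/andP; split.
  rewrite lerBrDl; apply: ub_le_sup => //; by exists (tpoly_coef P n + e).
by rewrite lerBlDl; apply: ge_sup => //; exists (tpoly_coef P n - e).
Qed.

Lemma fcoefB b b' w w' K L F G n : wiener_ball b w K F -> wiener_ball b' w' L G ->
  fcoef (fun z => F z - G z) n = fcoef F n - fcoef G n.
Proof.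
move=> FK GL; apply/eqP; rewrite -subr_eq0 -normr_eq0 eq_le normr_ge0 andbT.
apply/ler_addgt0Pr => e e0; rewrite add0r.
have e4 : 0 < e / 4 by rewrite divr_gt0.
have [P [_ _ FP]] := FK _ e4; have [Q [_ _ GQ]] := GL _ e4.
have FGPQ z : cmod (F z - G z - tpoly_eval (P ++ tpoly_opp Q) z) <= e / 4 + e / 4.
  rewrite tpoly_eval_cat tpoly_eval_opp opprD opprK addrACA.
  rewrite (le_trans (cmodD _ _)) // lerD // -cmodN opprD opprK; exact: GQ.
have := fcoef_close n FGPQ; have := fcoef_close n FP; have := fcoef_close n GQ.
rewrite tpoly_coef_cat tpoly_coef_opp !ler_norml.
by move=> /andP[? ?] /andP[? ?] /andP[? ?]; apply/andP; split; lra.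
Qed.

Lemma fcoef_ge0 w K F n : wiener_ball true w K F -> 0 <= fcoef F n.
Proof.
move=> FK; apply/ler_addgt0Pr => e e0; have [P [/= bP _ FP]] := FK _ e0.
have := fcoef_close n FP; have := tpoly_coef_ge0 n bP.
by rewrite ler_norml => ? /andP[? ?]; lra.
Qed.

(** For nonnegative [a] this is a bound on the sum over all integers. *)
Definition sums_le (a : int -> R) K : Prop :=
  forall s : seq int, uniq s -> \sum_(n <- s) a n <= K.

Lemma fcoef_sums_le b w K F : weight w -> wiener_ball b w K F ->
  sums_le (fun n => `|fcoef F n| * w n) K.
Proof.
move=> hw FK s us; apply/ler_addgt0Pr => e e0.
pose W := \sum_(n <- s) w n.
have W0 : 0 <= W by apply: sumr_ge0 => n _; exact: weight_ge0.
have W1 : 0 < W + 1 by lra.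
have e2 : 0 < e / (W + 1) by rewrite divr_gt0.
have [P [_ PK FP]] := FK _ e2.
apply: (@le_trans _ _ (\sum_(n <- s) (`|tpoly_coef P n| * w n + e / (W + 1) * w n))).
  apply: ler_sum => n _; rewrite -mulrDl ler_wpM2r ?weight_ge0 //.
  have := fcoef_close n FP; rewrite -lerBlDl; apply: le_trans.
  exact: lerB_dist.
rewrite big_split /= lerD //.
  by rewrite (le_trans (tpoly_norm_coef _ _ us)) // => n; exact: weight_ge0.
rewrite -mulr_sumr -/W mulrAC -mulrA ler_piMr ?(ltW e0) //.
by rewrite ler_pdivrMr // mul1r lerDl.
Qed.

End wiener_ball.

(** * Summable families over the integers and their Fourier series *)

Section summable_families.
Variable R : realType.
Implicit Types (a : int -> R) (w : int -> R) (K e : R) (F G : R -> R[i]).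

Definition int_range (N : nat) : seq int :=
  [seq i%:Z - N%:Z | i <- iota 0 N.*2.+1].

Lemma mem_int_range N (n : int) : (n \in int_range N) = (`|n| <= N)%N.
Proof.
apply/mapP/idP => [[k]|nN].
  by rewrite mem_iota add0n => /andP[_ kN] ->; lia.
exists (`|(n + N%:Z)%R|)%N; last by lia.
by rewrite mem_iota; lia.
Qed.

Lemma int_range_uniq N : uniq (int_range N).
Proof. by rewrite map_inj_uniq ?iota_uniq // => i j /addIr; case. Qed.

Lemma sums_le_mono a b K L : (forall n, a n <= b n) -> K <= L ->
  sums_le b K -> sums_le a L.
Proof.
move=> ab KL bK s us; apply: le_trans KL; apply: le_trans (bK s us).
by apply: ler_sum => n _.
Qed.

Lemma sums_leD a b K L : sums_le a K -> sums_le b L ->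
  sums_le (fun n => a n + b n) (K + L).
Proof. by move=> aK bL s us; rewrite big_split lerD ?aK ?bL. Qed.

Lemma sums_leZ a K c : 0 <= c -> sums_le a K -> sums_le (fun n => c * a n) (c * K).
Proof. by move=> c0 aK s us; rewrite -mulr_sumr ler_wpM2l ?aK. Qed.

Lemma sums_le_range a N : (forall n, 0 <= a n) ->
  sums_le (fun n => if (`|n| <= N)%N then a n else 0) (\sum_(n <- int_range N) a n).
Proof.
move=> a0 s us; rewrite -big_mkcond -big_filter.
have fs : {subset [seq n <- s | (`|n| <= N)%N] <= int_range N}.
  by move=> n; rewrite mem_filter mem_int_range => /andP[].
rewrite [leRHS](bigID (mem [seq n <- s | (`|n| <= N)%N])) /= -[leLHS]addr0.
rewrite lerD ?sumr_ge0 // -[leRHS]big_filter le_eqVlt; apply/orP; left.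
apply/eqP/perm_big; apply: uniq_perm; rewrite ?filter_uniq ?int_range_uniq //.
by move=> n; rewrite [in RHS]mem_filter -[RHS]/(_ && _) andb_idr // => /fs.
Qed.

(** A finite sum within [e] of the supremum exhausts all but [e] of the mass. *)
Lemma sums_le_tail a K e : (forall n, 0 <= a n) -> sums_le a K -> 0 < e ->
  exists N : nat, sums_le (fun n => if (`|n| <= N)%N then 0 else a n) e.
Proof.
move=> a0 aK e0.
pose S := [set x | exists2 s : seq int, uniq s & x = \sum_(n <- s) a n].
have Sub : has_ubound S by exists K => _ [s us ->]; exact: aK.
have hS : has_sup S by split=> //; exists 0, [::]; rewrite ?big_nil.
have [_ [s0 us0 ->] s0e] := sup_adherent e0 hS.
pose N := (\max_(n <- s0) `|n|)%N; exists N => s us.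
pose s' := [seq n <- s | ~~ (`|n| <= N)%N].
have -> : \sum_(n <- s) (if (`|n| <= N)%N then 0 else a n) = \sum_(n <- s') a n.
  rewrite big_filter [RHS]big_mkcond; apply: eq_bigr => n _.
  by rewrite if_neg.
have us' : uniq (s0 ++ s').
  rewrite cat_uniq us0 filter_uniq // andbT; apply/hasPn => n.
  rewrite mem_filter => /andP[nN _]; apply: contra nN => ns0.
  exact: (@leq_bigmax_seq _ _ _ (fun n : int => `|n|%N)).
have : \sum_(n <- s0 ++ s') a n <= sup S.
  by apply: ub_le_sup; [case: hS | exists (s0 ++ s')].
by rewrite big_cat /=; move: s0e; lra.
Qed.

Definition fourier_trunc a N : seq (R * int) := [seq (a n, n) | n <- int_range N].

(** Symmetric partial sums; absolute convergence is a separate hypothesis. *)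
Definition fourier_series a F : Prop := forall e, 0 < e ->
  exists N0 : nat, forall N z, (N0 <= N)%N ->
    cmod (F z - tpoly_eval (fourier_trunc a N) z) <= e.

Lemma tpoly_eval_trunc a N z : tpoly_eval (fourier_trunc a N) z =
  \sum_(n <- int_range N) (a n)%:C * tone n z.
Proof. exact: big_map. Qed.

Lemma tpoly_coef_trunc a N n :
  tpoly_coef (fourier_trunc a N) n = if (`|n| <= N)%N then a n else 0.
Proof.
rewrite /tpoly_coef big_map -big_filter -mem_int_range.
case: ifP => nN.
  rewrite (perm_big [:: n]) ?big_seq1 //; apply: uniq_perm => //.
    by rewrite filter_uniq // int_range_uniq.
  by move=> m; rewrite mem_filter mem_seq1 andb_idr /= => [|/eqP ->].
rewrite big_filter big_seq_cond big_pred0 // => m.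
by case: (eqVneq m n) => [->|]; rewrite ?nN ?andbF.
Qed.

Lemma tpoly_norm_trunc w a N :
  tpoly_norm w (fourier_trunc a N) = \sum_(n <- int_range N) `|a n| * w n.
Proof. by rewrite /tpoly_norm big_map. Qed.

Lemma fcoef_fourier a F n : fourier_series a F -> fcoef F n = a n.
Proof.
move=> aF; apply/eqP; rewrite -subr_eq0 -normr_eq0 eq_le normr_ge0 andbT.
apply/ler_addgt0Pr => e e0; rewrite add0r; have [N0 H] := aF _ e0.
have := fcoef_close n (fun z => H (maxn N0 `|n|) z (leq_maxl _ _)).
by rewrite tpoly_coef_trunc leq_maxr.
Qed.

Lemma fourier_wiener_ball (b : bool) w a K F : (b -> forall n, 0 <= a n) ->
  fourier_series a F -> sums_le (fun n => `|a n| * w n) K ->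
  wiener_ball b w K F.
Proof.
move=> ba aF aK e e0; have [N0 H] := aF _ e0.
exists (fourier_trunc a N0); split; last by move=> z; exact: H.
  apply/implyP => hb; rewrite /nonneg_coefs all_map; apply/allP => n _ /=.
  exact: ba.
by rewrite tpoly_norm_trunc aK // int_range_uniq.
Qed.

Lemma fourier_seriesB a b F G : fourier_series a F -> fourier_series b G ->
  fourier_series (fun n => a n - b n) (fun z => F z - G z).
Proof.
move=> aF bG e e0; have e2 : 0 < e / 2 by rewrite divr_gt0.
have [N1 H1] := aF _ e2; have [N2 H2] := bG _ e2.
exists (maxn N1 N2) => N z; rewrite geq_max => /andP[N1N N2N].
have -> : tpoly_eval (fourier_trunc (fun n => a n - b n) N) z =
  tpoly_eval (fourier_trunc a N) z - tpoly_eval (fourier_trunc b N) z.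
  rewrite !tpoly_eval_trunc -sumrB; apply: eq_bigr => n _ /=.
  by rewrite rmorphB mulrBl.
rewrite opprD addrACA -opprD (le_trans (cmodB _ _)) // (splitr e).
by rewrite lerD ?H1 ?H2.
Qed.

Lemma fourier_series_trunc a N :
  fourier_series (fun n => if (`|n| <= N)%N then a n else 0)
    (tpoly_eval (fourier_trunc a N)).
Proof.
move=> e e0; exists N => M z NM.
suff -> : tpoly_eval (fourier_trunc (fun n => if (`|n| <= N)%N then a n else 0) M) z =
  tpoly_eval (fourier_trunc a N) z by rewrite subrr cmod0 ltW.
rewrite !tpoly_eval_trunc.
transitivity (\sum_(n <- int_range M)
    if (`|n| <= N)%N then (a n)%:C * tone n z else 0).
  by apply: eq_bigr => n _; case: ifP; rewrite ?mul0r.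
rewrite -big_mkcond -big_filter; apply: perm_big; apply: uniq_perm.
- by rewrite filter_uniq // int_range_uniq.
- exact: int_range_uniq.
- move=> n; rewrite mem_filter !mem_int_range andb_idr // => nN.
  exact: leq_trans NM.
Qed.

End summable_families.

(** * Weights *)

Section weights.
Variable R : realType.
Implicit Types (w H h : int -> R) (n m s : int).

(** The GRS condition, as it is used: the weight is subexponential. *)
Definition subexponential H : Prop := forall d : R, 0 < d ->
  exists C : R, forall n, H n <= C * expR (d * `|n|%N%:R).

(** Truncation keeps a weight submultiplicative because weights are at least 1. *)
Lemma weight_min w (M : R) : weight w -> 1 <= M ->
  weight (fun n => Num.min (w n) M).
Proof.
move=> [w0 w1 wM] M1; split.
- by rewrite w0 min_l.
- by move=> n; rewrite le_min w1.
- move=> n m; have := wM n m; have := w1 n; have := w1 m.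
  rewrite /Num.min; do 3 case: ifP => ?; nra.
Qed.

(** A subexponential weight may be replaced by an equivalent one that is close
    to 1 on any prescribed window: the infimal convolution, in multiplicative
    form, of the weight and of an exponential. *)
Lemma weight_flatten H (d : R) : weight H -> subexponential H -> 0 < d ->
  exists w C, [/\ weight w, forall n, w n <= H n,
    forall n, w n <= expR (d * `|n|%N%:R), 0 <= C & forall n, H n <= C * w n].
Proof.
move=> hH gH d0; have [H0 H1 HM] := hH; have [C HC] := gH _ d0.
pose E n := expR (d * `|n|%N%:R).
have E1 n : 1 <= E n by rewrite -expR0 ler_expR mulr_ge0 // ltW.
have EM n m : E (n + m) <= E n * E m.
  rewrite -expRD ler_expR -mulrDr ler_wpM2l ?(ltW d0) // -natrD ler_nat; lia.
pose S n := [set x | exists s, x = H (n - s) * E s].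
pose w n := inf (S n).
have S0 n : S n !=set0 by exists (H (n - 0) * E 0), 0.
have Slb n : lbound (S n) 1.
  by move=> _ [s ->]; rewrite -[1]mulr1 ler_pM.
(* The infimum over [s] may be tested at [s = n], [s = 0], or at a sum. *)
have wle n s : w n <= H (n - s) * E s.
  by apply: ge_inf; [exists 1; exact: Slb | exists s].
have lew n x : (forall s, x <= H (n - s) * E s) -> x <= w n.
  by move=> xs; apply: lb_le_inf => // _ [s ->].
have w1 n : 1 <= w n by apply: (lew) => s; rewrite -[1]mulr1 ler_pM.
have wE n : w n <= E n by rewrite (le_trans (wle n n)) // subrr H0 mul1r.
have E0 : E 0 = 1 by rewrite /E mulr0 expR0.
have wH n : w n <= H n by rewrite (le_trans (wle n 0)) // subr0 E0 mulr1.
have C0 : 0 < C by have := HC 0; rewrite -/(E 0) E0 mulr1 H0; lra.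
exists w, C; split => //; last 2 first.
- exact: ltW.
- move=> n; rewrite mulrC -ler_pdivrMr //; apply: (lew) => s.
  rewrite ler_pdivrMr // -mulrA -{1}(subrK s n) (le_trans (HM _ _)) //.
  by rewrite ler_wpM2l ?(le_trans ler01) // mulrC HC.
split => //; first by apply/eqP; rewrite eq_le w1 -E0 wE.
move=> n m; have wm0 : 0 < w m by exact: lt_le_trans (w1 m).
rewrite -ler_pdivrMr //; apply: (lew) => s.
have q0 : 0 < H (n - s) * E s by exact: lt_le_trans (Slb n _ (ex_intro _ s erefl)).
rewrite ler_pdivrMr // mulrC -ler_pdivrMr //; apply: (lew) => t.
rewrite ler_pdivrMr // (le_trans (wle _ (t + s))) // mulrACA.
rewrite ler_pM ?(le_trans ler01) //.
by rewrite (_ : n + m - (t + s) = (m - t) + (n - s)) ?HM //; ring.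
Qed.

(** The constant [B] disappears, and the value 1 at 0 makes the constant
    function 1 have norm 1. *)
Definition normalize_weight (B : R) h n : R :=
  if n == 0 then 1 else Num.max (B * h n) 1.

Lemma normalize_weightP (B : R) h : 0 < B -> (forall n, 0 <= h n) ->
  (forall n m, h (n + m) <= B * h n * h m) -> weight (normalize_weight B h).
Proof.
move=> B0 h0 hB; rewrite /normalize_weight.
have g1 n : 1 <= (if n == 0 then 1 else Num.max (B * h n) 1).
  by case: ifP => // _; rewrite le_max lexx orbT.
split => // n m.
case: (eqVneq n 0) => [->|n0]; first by rewrite add0r mul1r.
case: (eqVneq m 0) => [->|m0]; first by rewrite addr0 (negbTE n0) mulr1.
have := g1 n; have := g1 m; rewrite (negbTE n0) (negbTE m0) => gm gn.
case: ifP => _; first by nra.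
rewrite ge_max; apply/andP; split; last by nra.
apply: (@le_trans _ _ ((B * h n) * (B * h m))).
  by rewrite -mulrA ler_pM2l // mulrCA mulrA hB.
by rewrite ler_pM ?mulr_ge0 ?(ltW B0) // le_max lexx.
Qed.

(** The maximum with 1 only costs a multiple of the total mass. *)
Lemma normalize_weight_sums (B : R) h (a : int -> R) A : 0 < B ->
  (forall n, 0 <= h n) -> (forall n, 0 <= a n) -> sums_le a A ->
  (exists K, sums_le (fun n => h n * a n) K) <->
  (exists K, sums_le (fun n => normalize_weight B h n * a n) K).
Proof.
move=> B0 h0 a0 aA; have Bi : 0 <= B^-1 by rewrite invr_ge0 ltW.
split=> -[K hK].
  exists (B * K + A); apply: (sums_le_mono _ (lexx _) (sums_leD (sums_leZ (ltW B0) hK) aA)) => n.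
  rewrite mulrA -[X in _ + X]mul1r -mulrDl ler_wpM2r // /normalize_weight.
  have := mulr_ge0 (ltW B0) (h0 n).
  by case: ifP => _ ?; rewrite ?ge_max; [lra|apply/andP; split; lra].
exists ((h 0 + B^-1) * K); apply: (sums_le_mono _ (lexx _) (sums_leZ _ hK)); last first.
  by rewrite addr_ge0.
move=> n; rewrite mulrA ler_wpM2r // /normalize_weight.
case: eqVneq => [->|_]; first by rewrite mulr1 lerDl.
rewrite mulrDl -[leLHS]add0r lerD //.
  by rewrite mulr_ge0 // le_max ler01 orbT.
by rewrite mulrC ler_pdivlMr // mulrC le_max lexx.
Qed.

End weights.

(** * A weighted Wiener-Levy theorem for the logarithm *)

Section wiener_levy.
Variable R : realType.
Implicit Types (a : int -> R) (w H : int -> R) (K x e : R) (F G : R -> R[i]).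

Lemma exp_sum1 (F : fieldType) (x : F) : exp_sum 1 x = 1.
Proof. by rewrite /exp_sum big_nat1 expr0 fact0 divr1. Qed.

Lemma exp_sum2 (F : fieldType) (x : F) : exp_sum 2 x = 1 + x.
Proof.
by rewrite /exp_sum big_nat_recr //= big_nat1 expr0 expr1 !divr1.
Qed.

Lemma expR_sub_exp_sum2 x : 0 <= x -> x <= 1 / 2 ->
  expR x - exp_sum 2 x <= 2 * x ^+ 2.
Proof.
move=> x0 x2; rewrite exp_sum2.
have e0 := expR_gt0 x; have := expR_ge1Dx (- x).
have : expR x * expR (- x) = 1 by rewrite -expRD subrr expR0.
move: (expR (- x)) => y; move: (expR x) e0 => t t0 ty yx.
have tx : t * (1 - x) <= 1 by rewrite -[leRHS]ty ler_pM2l.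
have x1 : 0 < 1 - x by lra.
have xx : 0 <= x ^+ 2 * (1 / 2 - x) by rewrite mulr_ge0 ?sqr_ge0 ?subr_ge0.
rewrite -(ler_pM2r x1) -subr_ge0.
have -> : 2 * x ^+ 2 * (1 - x) - (t - (1 + x)) * (1 - x) =
  2 * (x ^+ 2 * (1 / 2 - x)) + (1 - t * (1 - x)) by field.
by rewrite addr_ge0 ?mulr_ge0 ?subr_ge0.
Qed.

Lemma weight_cst1 : weight (fun=> 1 : R).
Proof. by split => // *; rewrite mulr1. Qed.

(** If [exp r - 1] is small for the weight [w] and [r] is small for the weight
    1, then [r] is small for [w]. The a priori finite norms of [r] for the
    truncated weights [min w 2^j] cannot jump over the interval
    [[1/16, 1/8]]: they at most double from one [j] to the next, while
    [r = (exp r - 1) - (exp r - 1 - r)] bounds a norm [x <= 1/8] by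
    [1/32 + 2 x^2 <= 1/16]. *)
Lemma small_log w a F : weight w -> fourier_series a F ->
  sums_le (fun n => `|a n|) 16^-1 ->
  sums_le (fun n => `|fcoef (fun z => cexp (F z) - 1) n| * w n) 32^-1 ->
  sums_le (fun n => `|a n| * w n) 16^-1.
Proof.
move=> hw aF a16 u32; have [_ w1 _] := hw.
pose W (j : nat) n := Num.min (w n) (2 ^+ j).
have one2 j : 1 <= 2 ^+ j :> R by rewrite exprn_ege1 // ler1n.
have hW j : weight (W j) by exact: weight_min.
have aW j : sums_le (fun n => `|a n| * W j n) 16^-1.
  elim: j => [|j IH].
    apply: (sums_le_mono _ (lexx _) a16) => n.
    by rewrite /W expr0 min_r ?mulr1.
  have a8 : sums_le (fun n => `|a n| * W j.+1 n) 8^-1.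
    have -> : 8^-1 = 2 * 16^-1 :> R by lra.
    apply: (sums_le_mono _ (lexx _) (sums_leZ (ler0n _ 2) IH)) => n.
    rewrite mulrCA ler_wpM2l // /W exprS.
    by rewrite minr_pMr ?ler0n // le_min !ge_min lexx orbT /= ler_peMl ?ler1n ?(le_trans ler01).
  have F8 : wiener_ball false (W j.+1) 8^-1 F by exact: (fourier_wiener_ball _ aF a8).
  have E32 : sums_le
      (fun n => `|fcoef (fun z => cexp (F z) - exp_sum 2 (F z)) n| * W j.+1 n) 32^-1.
    have := fcoef_sums_le (hW j.+1) (wiener_ball_cexp 2 (hW j.+1) F8).
    apply: sums_le_mono => // ; apply: le_trans (expR_sub_exp_sum2 _ _) _; lra.
  have -> : 16^-1 = 32^-1 + 32^-1 :> R by lra.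
  apply: (sums_le_mono _ (lexx _) (sums_leD u32 E32)) => n.
  have u1 := wiener_ball_cexp 1 (hW j.+1) F8.
  have -> : a n = fcoef (fun z => cexp (F z) - 1) n -
      fcoef (fun z => cexp (F z) - exp_sum 2 (F z)) n.
    rewrite -(fcoef_fourier n aF).
    rewrite (_ : (fun z => cexp (F z) - 1) = (fun z => cexp (F z) - exp_sum 1 (F z))).
      rewrite -(fcoefB n u1 (wiener_ball_cexp 2 (hW j.+1) F8)).
      congr (fcoef _ n); apply/funext => z.
      by rewrite exp_sum1 exp_sum2; ring.
    by apply/funext => z; rewrite exp_sum1.
  have W0 : 0 <= W j.+1 n by exact: weight_ge0 (hW j.+1).
  rewrite (le_trans (ler_wpM2r W0 (ler_normB _ _))) // mulrDl lerD2r.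
  by rewrite ler_wpM2l // /W ge_min lexx.
move=> s us; pose M := \sum_(n <- s) w n.
have [j Mj] : exists j : nat, M <= 2 ^+ j.
  exists (Num.bound M); apply: le_trans (ltW (archi_boundP _)) _.
    by apply: sumr_ge0 => n _; exact: weight_ge0.
  by rewrite -natrX ler_nat ltnW // ltn_expl.
rewrite (le_trans _ (aW j s us)) //; rewrite [leLHS]big_seq [leRHS]big_seq.
apply: ler_sum => n ns; rewrite ler_wpM2l // /W le_min lexx /=.
rewrite (le_trans _ Mj) // /M (big_rem n ns) /= lerDl sumr_ge0 // => m _.
exact: weight_ge0.
Qed.

(** Remove from [F] a trigonometric polynomial so that the rest [r] is small for
    the weight 1; then [exp r] still lies in the algebra of [H], and since the
    high coefficients of [exp r - 1] are negligible, flattening [H] on the window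
    of the others makes [exp r - 1] small for an equivalent weight. *)
Theorem wiener_levy_log H a F A K : weight H -> subexponential H ->
  fourier_series a F -> sums_le (fun n => `|a n|) A ->
  wiener_ball false H K (fun z => cexp (F z)) ->
  exists L, sums_le (fun n => `|a n| * H n) L.
Proof.
move=> hH gH aF aA FK.
(* With [1/256], the low coefficients of [exp r - 1] contribute at most
   [2 * 1/128 = 1/64] to its norm for [w], and the high ones another [1/64]. *)
have [N1 aN1] := sums_le_tail (fun n => normr_ge0 (a n)) aA
  (ltac:(rewrite invr_gt0 ltr0n //) : 0 < 256%:R^-1).
pose r z := F z - tpoly_eval (fourier_trunc a N1) z.
pose b n := a n - if (`|n| <= N1)%N then a n else 0.
have br : fourier_series b r := fourier_seriesB aF (fourier_series_trunc a N1).
have b256 : sums_le (fun n => `|b n|) 256^-1.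
  apply: (sums_le_mono _ (lexx _) aN1) => n; rewrite /b.
  by case: ifP => _; rewrite ?subrr ?normr0 ?subr0.
pose u z := cexp (r z) - 1.
have r1 : wiener_ball false (fun=> 1) 256^-1 r.
  apply: (fourier_wiener_ball _ br) => //.
  by apply: (sums_le_mono _ (lexx _) b256) => n; rewrite mulr1.
have u128 : sums_le (fun n => `|fcoef u n|) 128^-1.
  have := fcoef_sums_le weight_cst1 (wiener_ball_cexp 1 weight_cst1 r1).
  apply: sums_le_mono => [n|].
    by rewrite mulr1 /u; under [X in _ <= `|fcoef X n|]eq_fun do rewrite exp_sum1.
  have := @expR_sub_exp_sum2 256^-1; rewrite exp_sum1 exp_sum2; lra.
have [L uL] : exists L, sums_le (fun n => `|fcoef u n| * H n) L.
  have Pb := wiener_ballN (@wiener_ball_tpoly _ false H (fourier_trunc a N1) isT).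
  have := wiener_ballD (wiener_ballM hH FK (wiener_ball_cexp 0 hH Pb))
    (wiener_ballN (wiener_ball_cst false hH ler01)).
  move=> /(fcoef_sums_le hH) => uL; eexists; move: uL; congr (sums_le _ _).
  apply/funext => n; congr (`|fcoef _ n| * _); apply/funext => z.
  by rewrite /exp_sum big_geq // subr0 -cexpD.
have [N2 uN2] := sums_le_tail (fun n => mulr_ge0 (normr_ge0 (fcoef u n))
  (weight_ge0 n hH)) uL (ltac:(rewrite invr_gt0 ltr0n //) : 0 < 64%:R^-1).
have N20 : 0 < N2.+1%:R :> R by rewrite ltr0n.
have d0 : 0 < (2 * N2.+1%:R)^-1 :> R by rewrite invr_gt0 mulr_gt0.
have [w [C [hw wH wE C0 HC]]] := weight_flatten hH gH d0.
(* On the window the exponential is at most [exp (1/2) <= 2]. *)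
have w2 n : (`|n| <= N2)%N -> w n <= 2.
  move=> nN; apply: le_trans (wE n) _.
  have : (2 * N2.+1%:R)^-1 * `|n|%N%:R <= 2^-1 :> R.
    by rewrite invfM -mulrA ler_piMr // mulrC ler_pdivrMr // mul1r ler_nat leqW.
  rewrite -ler_expR => /le_trans; apply.
  have := expR_ge1Dx (- 2^-1 : R).
  have : expR 2^-1 * expR (- 2^-1) = 1 :> R by rewrite -expRD subrr expR0.
  have := expR_gt0 (2^-1 : R); nra.
have u32 : sums_le (fun n => `|fcoef u n| * w n) 32^-1.
  have -> : 32^-1 = 2 * 128^-1 + 64^-1 :> R by lra.
  apply: (sums_le_mono _ (lexx _) (sums_leD (sums_leZ (ler0n _ 2) u128) uN2)) => n.
  case: ifP => [/w2 wn|_]; first by rewrite addr0 mulrC ler_wpM2r.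
  by rewrite (le_trans (ler_wpM2l _ (wH n))) // lerDr mulr_ge0.
have bw : sums_le (fun n => `|b n| * w n) 16^-1.
  apply: small_log br _ u32 => //.
  by apply: sums_le_mono b256 => //; lra.
exists (C * 16^-1 + \sum_(n <- int_range N1) `|a n| * H n).
have aH0 n : 0 <= `|a n| * H n by rewrite mulr_ge0 // weight_ge0.
apply: (sums_le_mono _ (lexx _) (sums_leD (sums_leZ C0 bw) (sums_le_range N1 aH0))).
move=> n; rewrite /b; case: ifP => _; first by rewrite subrr normr0 mul0r mulr0 add0r.
by rewrite subr0 addr0 mulrCA ler_wpM2l.
Qed.

End wiener_levy.

(** * Equivalence of the moments at the level of point masses *)

Section point_masses.
Variable R : realType.
Variables (H m p q : int -> R) (M P Q : R -> R[i]) (k : int) (c A : R).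
Hypotheses (hH : weight H) (c0 : 0 < c).
Hypotheses (m0 : forall n, 0 <= m n) (p0 : forall n, 0 <= p n)
  (q0 : forall n, 0 <= q n).
Hypotheses (mA : sums_le m A) (pA : sums_le p A) (qA : sums_le q A).
Hypotheses (mM : fourier_series m M) (pP : fourier_series p P)
  (qQ : fourier_series q Q).
Hypothesis ME : forall z, M z = c%:C * tone k z * cexp (P z - Q z).

(** [M exp Q = c tone_k exp P], and [M exp Q] dominates [M] coefficientwise as
    [exp Q - 1] has nonnegative coefficients. *)
Lemma moment_of_pos_part : (exists K, sums_le (fun n => H n * p n) K) ->
  exists K, sums_le (fun n => H n * m n) K.
Proof.
move=> [K pK]; have h1 := @weight_cst1 R.
have ball1 a F : (forall n, 0 <= a n) -> sums_le a A -> fourier_series a F ->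
    wiener_ball true (fun=> 1) A F.
  move=> a0 aA aF; apply: (fourier_wiener_ball _ aF) => //.
  by apply: (sums_le_mono _ (lexx _) aA) => n; rewrite mulr1 ger0_norm.
have M1 := ball1 _ _ m0 mA mM; have Q1 := ball1 _ _ q0 qA qQ.
have X1 := wiener_ballM h1 M1 (wiener_ball_cexp 1 h1 Q1).
have PK : wiener_ball false H K P.
  apply: (fourier_wiener_ball _ pP) => //.
  by apply: (sums_le_mono _ (lexx _) pK) => n; rewrite ger0_norm // mulrC.
have := wiener_ballM hH (@wiener_ball_tone _ false H k c isT)
  (wiener_ball_cexp 0 hH PK).
set F := (fun z => _) => FL.
have FM : (fun z => F z - M z) = (fun z => M z * (cexp (Q z) - exp_sum 1 (Q z))).
  apply/funext => z; rewrite /F exp_sum1 /exp_sum big_geq // subr0 ME.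
  have <- : cexp (P z - Q z) * cexp (Q z) = cexp (P z) by rewrite -cexpD subrK.
  by ring.
eexists; apply: (sums_le_mono _ (lexx _) (fcoef_sums_le hH FL)) => n.
rewrite mulrC ler_wpM2r ?weight_ge0 // -(fcoef_fourier n mM).
rewrite (le_trans _ (ler_norm _)) // -subr_ge0 -(fcoefB n FL M1) FM.
exact: fcoef_ge0 X1.
Qed.

(** Here [exp (P - Q)] is [M] up to a constant and a translation of the
    frequencies, hence has finite norm for [H]. *)
Lemma total_variation_moment : subexponential H ->
  (forall n, `|p n - q n| = p n + q n) ->
  (exists K, sums_le (fun n => H n * m n) K) ->
  exists K, sums_le (fun n => H n * (p n + q n)) K.
Proof.
move=> gH pq [K mK].
have MK : wiener_ball false H K M.
  apply: (fourier_wiener_ball _ mM) => //.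
  by apply: (sums_le_mono _ (lexx _) mK) => n; rewrite ger0_norm // mulrC.
have := wiener_ballM hH (@wiener_ball_tone _ false H (- k) c^-1 isT) MK.
have -> : (fun z => (c^-1)%:C * tone (- k) z * M z) = (fun z => cexp (P z - Q z)).
  apply/funext => z; have tk : tone (- k) z * tone k z = 1.
    by rewrite -toneD addNr tone0.
  have cc : (c^-1)%:C * c%:C = 1 by rewrite -rmorphM /= mulVf // gt_eqF.
  transitivity ((c^-1)%:C * c%:C * (tone (- k) z * tone k z) * cexp (P z - Q z)).
    by rewrite ME; ring.
  by rewrite cc tk !mul1r.
move=> EK; have pqA : sums_le (fun n => `|p n - q n|) (A + A).
  by apply: (sums_le_mono _ (lexx _) (sums_leD pA qA)) => n; rewrite pq.
have [L HL] := wiener_levy_log hH gH (fourier_seriesB pP qQ) pqA EK.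
by exists L; move: HL; congr sums_le; apply/funext => n; rewrite pq mulrC.
Qed.

End point_masses.

(** * Integration of bounded functions against finite measures and charges *)

Section bounded_integrals.
Context d (T : measurableType d) (R : realType).
Implicit Types (f g : T -> R) (A B D : set T) (m : {measure set T -> \bar R}).
Implicit Types (nu zeta : {charge set T -> \bar R}).

(** On these functions every integral against a finite measure or charge is
    linear, with no further integrability condition. *)
Definition bounded_mfun f : Prop :=
  measurable_fun setT f /\ exists K, forall x, `|f x| <= K.

Lemma bounded_mfunD f g : bounded_mfun f -> bounded_mfun g ->
  bounded_mfun (fun x => f x + g x).
Proof.
move=> [mf [K fK]] [mg [L gL]]; split; first exact: measurable_funD.
by exists (K + L) => x; rewrite (le_trans (ler_normD _ _)) // lerD.
Qed.

Lemma bounded_mfunM f g : bounded_mfun f -> bounded_mfun g ->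
  bounded_mfun (fun x => f x * g x).
Proof.
move=> [mf [K fK]] [mg [L gL]]; split; first exact: measurable_funM.
by exists (K * L) => x; rewrite normrM ler_pM.
Qed.

Lemma bounded_mfun_cst (c : R) : bounded_mfun (fun=> c).
Proof. by split; [exact: measurable_cst | exists `|c|]. Qed.

Lemma bounded_mfunZ (c : R) f : bounded_mfun f -> bounded_mfun (fun x => c * f x).
Proof. by move=> hf; apply: bounded_mfunM => //; exact: bounded_mfun_cst. Qed.

Lemma bounded_mfunB f g : bounded_mfun f -> bounded_mfun g ->
  bounded_mfun (fun x => f x - g x).
Proof.
move=> hf /(bounded_mfunZ (-1)) hg; have := bounded_mfunD hf hg.
by congr bounded_mfun; apply/funext => x; rewrite mulN1r.
Qed.

Lemma bounded_mfun_indic A : measurable A -> bounded_mfun (\1_A).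
Proof.
move=> mA; split; first exact: measurable_indic.
by exists 1 => x; rewrite indicE; case: (_ \in _); rewrite ?normr1 ?normr0.
Qed.

Lemma bounded_mfun_sum (I : Type) (s : seq I) (F : I -> T -> R) :
  (forall i, bounded_mfun (F i)) -> bounded_mfun (fun x => \sum_(i <- s) F i x).
Proof.
move=> hF; elim: s => [|a s IH].
  have := bounded_mfun_cst 0; congr bounded_mfun.
  by apply/funext => x; rewrite big_nil.
have := bounded_mfunD (hF a) IH; congr bounded_mfun.
by apply/funext => x; rewrite big_cons.
Qed.

Section finite_measure.
Variable m : {measure set T -> \bar R}.
Hypothesis m_fin : (m setT < +oo)%E.

Lemma bounded_integrable f : bounded_mfun f -> m.-integrable setT (EFin \o f).
Proof.
move=> [mf [K fK]]; apply: measurable_bounded_integrable => //.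
exists K; split; first exact: num_real.
by move=> L KL x _; exact: le_trans (fK x) (ltW KL).
Qed.

Lemma bintD f g : bounded_mfun f -> bounded_mfun g ->
  \int[m]_x (f x + g x) = \int[m]_x f x + \int[m]_x g x.
Proof. by move=> hf hg; rewrite RintegralD //; exact: bounded_integrable. Qed.

Lemma bintZ (c : R) f : bounded_mfun f -> \int[m]_x (c * f x) = c * \int[m]_x f x.
Proof. by move=> hf; rewrite RintegralZl //; exact: bounded_integrable. Qed.

Lemma bint_indic A : measurable A -> \int[m]_x (\1_A x) = fine (m A).
Proof. by move=> mA; rewrite /Rintegral integral_indic // setIT. Qed.

Lemma bint_le f g : bounded_mfun f -> bounded_mfun g -> (forall x, f x <= g x) ->
  \int[m]_x f x <= \int[m]_x g x.
Proof. by move=> hf hg fg; apply: le_Rintegral => //; exact: bounded_integrable. Qed.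

Lemma bint_norm_le f g : bounded_mfun f -> bounded_mfun g ->
  (forall x, `|f x| <= g x) -> `|\int[m]_x f x| <= \int[m]_x g x.
Proof.
move=> hf hg fg; have hNg := bounded_mfunZ (-1) hg.
rewrite ler_norml; apply/andP; split.
  rewrite -mulN1r -bintZ //; apply: bint_le => // x.
  by have := fg x; rewrite ler_norml mulN1r => /andP[].
by apply: bint_le => // x; rewrite (le_trans (ler_norm _)).
Qed.

Lemma bint_bound f (K : R) : bounded_mfun f -> (forall x, `|f x| <= K) ->
  `|\int[m]_x f x| <= K * fine (m setT).
Proof.
move=> hf fK; rewrite -Rintegral_cst //.
by apply: bint_norm_le => //; exact: bounded_mfun_cst.
Qed.

Lemma bint_sum (I : Type) (s : seq I) (F : I -> T -> R) :
  (forall i, bounded_mfun (F i)) ->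
  \int[m]_x (\sum_(i <- s) F i x) = \sum_(i <- s) \int[m]_x F i x.
Proof.
move=> hF; elim: s => [|a s IH].
  rewrite big_nil (_ : (fun x => _) = (fun=> 0 : R)).
    by rewrite Rintegral_cst // mul0r.
  by apply/funext => x; rewrite big_nil.
rewrite big_cons -IH -bintD //; last exact: bounded_mfun_sum.
by congr Rintegral; apply/funext => x; rewrite big_cons.
Qed.

Lemma bint_cvg (F : nat -> T -> R) f (K : R) :
  (forall n, measurable_fun setT (F n)) -> measurable_fun setT f ->
  (forall n x, `|F n x| <= K) -> (forall x, F n x @[n --> \oo] --> f x) ->
  \int[m]_x (F n x) @[n --> \oo] --> \int[m]_x f x.
Proof.
move=> mF mf FK Ff.
have fK x : `|f x| <= K.
  have /cvg_norm cf := Ff x.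
  by apply: (cvgr_to_le cf); apply: nearW => n; exact: FK.
have cE x : ((F n x)%:E @[n --> \oo] --> (f x)%:E)%E.
  by apply: cvg_EFin; [exact: nearW | exact: Ff].
have [_ _ H] := @dominated_convergence _ T R m setT measurableT
  (fun n => EFin \o F n) (EFin \o f) (cst K%:E)
  (fun n => (measurable_EFinP _ _).2 (mF n)) ((measurable_EFinP _ _).2 mf)
  (aeW m (fun x _ => cE x))
  (bounded_integrable (bounded_mfun_cst K))
  (aeW m (fun x n _ => FK n x)).
apply: fine_cvg; rewrite fineK; first exact: H.
apply: integrable_fin_num => //; apply: bounded_integrable; split => //.
by exists K.
Qed.

End finite_measure.

Section charges.
Variable nu : {charge set T -> \bar R}.

Lemma jordan_pos_part_fin A : measurable A -> jordan_pos_part nu A \is a fin_num.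
Proof. exact: (@fin_num_measure _ _ _ (jordan_pos (hahnP nu))). Qed.

Lemma jordan_neg_part_fin A : measurable A -> jordan_neg_part nu A \is a fin_num.
Proof. exact: (@fin_num_measure _ _ _ (jordan_neg (hahnP nu))). Qed.

Lemma jordan_pos_part_lty : (jordan_pos_part nu setT < +oo)%E.
Proof. by rewrite -ge0_fin_numE // jordan_pos_part_fin. Qed.

Lemma jordan_neg_part_lty : (jordan_neg_part nu setT < +oo)%E.
Proof. by rewrite -ge0_fin_numE // jordan_neg_part_fin. Qed.

Let pos_lty := jordan_pos_part_lty.
Let neg_lty := jordan_neg_part_lty.

Definition total_mass : R :=
  fine (jordan_pos_part nu setT) + fine (jordan_neg_part nu setT).

Lemma total_mass_ge0 : 0 <= total_mass.
Proof. by rewrite addr_ge0 // fine_ge0. Qed.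

Lemma charge_integral_mkcond D f :
  charge_integral nu D f = charge_integral nu setT (f \_ D).
Proof. by rewrite /charge_integral !(Rintegral_mkcond _ D). Qed.

Lemma charge_fineE A : measurable A ->
  fine (nu A) = fine (jordan_pos_part nu A) - fine (jordan_neg_part nu A).
Proof.
move=> mA; rewrite (jordan_decomp (hahnP nu) mA) /cadd /= cscaleN1 fineD //.
- by rewrite fineN.
- exact: jordan_pos_part_fin.
- by rewrite fin_numN; exact: jordan_neg_part_fin.
Qed.

Lemma cintD f g : bounded_mfun f -> bounded_mfun g ->
  charge_integral nu setT (fun x => f x + g x) =
  charge_integral nu setT f + charge_integral nu setT g.
Proof. by move=> hf hg; rewrite /charge_integral !bintD // opprD addrACA. Qed.

Lemma cintZ (c : R) f : bounded_mfun f ->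
  charge_integral nu setT (fun x => c * f x) = c * charge_integral nu setT f.
Proof. by move=> hf; rewrite /charge_integral !bintZ // mulrBr. Qed.

Lemma cintB f g : bounded_mfun f -> bounded_mfun g ->
  charge_integral nu setT (fun x => f x - g x) =
  charge_integral nu setT f - charge_integral nu setT g.
Proof.
move=> hf hg; rewrite -mulN1r -cintZ // -cintD //; last exact: bounded_mfunZ.
by congr charge_integral; apply/funext => x; rewrite mulN1r.
Qed.

Lemma cint_sum (I : Type) (s : seq I) (F : I -> T -> R) :
  (forall i, bounded_mfun (F i)) ->
  charge_integral nu setT (fun x => \sum_(i <- s) F i x) =
  \sum_(i <- s) charge_integral nu setT (F i).
Proof. by move=> hF; rewrite /charge_integral !bint_sum // sumrB. Qed.

Lemma cint_indic A : measurable A ->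
  charge_integral nu setT (\1_A) = fine (nu A).
Proof. by move=> mA; rewrite charge_fineE // /charge_integral !bint_indic. Qed.

Lemma cint_bound f (K : R) : bounded_mfun f -> (forall x, `|f x| <= K) ->
  `|charge_integral nu setT f| <= K * total_mass.
Proof.
move=> hf fK; rewrite (le_trans (ler_normB _ _)) // mulrDr.
by rewrite lerD // bint_bound.
Qed.

Lemma cint_cvg (F : nat -> T -> R) f (K : R) :
  (forall n, measurable_fun setT (F n)) -> measurable_fun setT f ->
  (forall n x, `|F n x| <= K) -> (forall x, F n x @[n --> \oo] --> f x) ->
  charge_integral nu setT (F n) @[n --> \oo] --> charge_integral nu setT f.
Proof.
move=> mF mf FK Ff; apply: cvgB.
- exact: (bint_cvg pos_lty mF mf FK Ff).
- exact: (bint_cvg neg_lty mF mf FK Ff).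
Qed.

End charges.

(** The sum counts the multiples of [e] between [e] and [y]: it is [y] rounded
    down to a multiple of [e]. *)
Lemma staircase_le (e y : R) (n : nat) : 0 < e -> 0 <= y -> y <= n%:R * e ->
  `|y - \sum_(0 <= j < n) e * (j.+1%:R * e <= y)%R%:R| <= e.
Proof.
move=> e0 y0.
have full k : k%:R * e <= y -> \sum_(0 <= j < k) e * (j.+1%:R * e <= y)%R%:R = k%:R * e.
  move=> ky; rewrite big_nat_cond (eq_bigr (fun=> e)).
    by rewrite -big_nat_cond big_const_nat subn0 iter_addr_0 mulr_natl.
  move=> j /andP[/andP[_ jk] _]; rewrite (le_trans _ ky) ?mulr1 //.
  by rewrite ler_pM2r // ler_nat.
elim: n => [|n IH] yn.
  by rewrite big_geq // subr0 ger0_norm // (le_trans yn) // mul0r ltW.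
rewrite big_nat_recr //=; case: (leP (n.+1%:R * e) y) => [ny|ny].
  have ny' : n%:R * e <= y by rewrite (le_trans _ ny) // ler_pM2r // ler_nat.
  rewrite full // mulr1 [y](_ : _ = n.+1%:R * e); last by apply/le_anti/andP.
  by rewrite -natr1 mulrDl mul1r subrr normr0 ltW.
rewrite mulr0 addr0; case: (leP y (n%:R * e)) => [/IH //|ny'].
rewrite full ?(ltW ny') // ger0_norm ?subr_ge0 ?(ltW ny') //.
by move: ny; rewrite -natr1 mulrDl mul1r; lra.
Qed.

(** Round [f + K] down, where [K] bounds the absolute value of [f]: the result
    is a sum of indicators of superlevel sets. *)
Lemma bounded_mfun_step f (e : R) : bounded_mfun f -> 0 < e ->
  exists (n : nat) (c : R) (B : nat -> set T), (forall j, measurable (B j)) /\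
    forall x, `|f x - (c + \sum_(0 <= j < n) e * \1_(B j) x)| <= e.
Proof.
move=> [mf [K fK]] e0; pose n := Num.bound ((`|K| + `|K|) / e).
pose B (j : nat) := [set x | j.+1%:R * e <= f x + `|K|].
exists n, (- `|K|), B; split => [j|x].
  rewrite -[B j]setTI.
  have : measurable_fun setT (fun x => f x + `|K|).
    by apply: measurable_funD => //; exact: measurable_cst.
  by move/(_ measurableT _ (measurable_itv `[j.+1%:R * e, +oo[));
    congr measurable; apply/seteqP; split => y /=; rewrite in_itv /= andbT.
rewrite opprD opprK addrA.
have -> : \sum_(0 <= j < n) e * \1_(B j) x =
  \sum_(0 <= j < n) e * (j.+1%:R * e <= f x + `|K|)%R%:R.
  apply: eq_bigr => j _; rewrite indicE; congr (_ * _%:R).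
  by rewrite /B; case: (leP _ (f x + _)) => h;
    [rewrite mem_set | rewrite memNset //= => /le_lt_trans /(_ h); rewrite ltxx].
have fK' : `|f x| <= `|K| by rewrite (le_trans (fK x)) // ler_norm.
move: (fK'); rewrite ler_norml => /andP[f1 f2].
apply: staircase_le => //; first by lra.
rewrite -ler_pdivrMr //; apply: le_trans (ltW (archi_boundP _)).
  by rewrite ler_pM2r ?invr_gt0 // lerD2r.
by rewrite divr_ge0 // ?addr_ge0 // ltW.
Qed.

(** Change of measure between charges. Both sides are linear in [f], continuous
    for uniform convergence, and agree on indicators. *)
Lemma charge_density nu zeta D (k : T -> R) : measurable D ->
  bounded_mfun (fun x => k x * \1_D x) ->
  (forall B, measurable B -> B `<=` D -> nu B = (charge_integral zeta B k)%:E) ->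
  forall f, bounded_mfun f ->
  charge_integral zeta setT (fun x => f x * (k x * \1_D x)) =
  charge_integral nu setT (fun x => f x * \1_D x).
Proof.
move=> mD hk nuE f hf; have hD := bounded_mfun_indic mD.
pose L g := charge_integral zeta setT (fun x => g x * (k x * \1_D x)) -
  charge_integral nu setT (fun x => g x * \1_D x).
have LD g h : bounded_mfun g -> bounded_mfun h -> L (fun x => g x + h x) = L g + L h.
  move=> hg hh; rewrite /L.
  under [X in charge_integral zeta _ X]eq_fun do rewrite mulrDl.
  under [X in charge_integral nu _ X]eq_fun do rewrite mulrDl.
  by rewrite !cintD ?opprD 1?addrACA //; exact: bounded_mfunM.
have LZ c g : bounded_mfun g -> L (fun x => c * g x) = c * L g.
  move=> hg; rewrite /L.
  under [X in charge_integral zeta _ X]eq_fun do rewrite -mulrA.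
  under [X in charge_integral nu _ X]eq_fun do rewrite -mulrA.
  by rewrite !cintZ ?mulrBr //; exact: bounded_mfunM.
have L1 B : measurable B -> L (\1_B) = 0.
  move=> mB; have mBD : measurable (B `&` D) by exact: measurableI.
  have := nuE _ mBD (@subIsetr _ _ _) => /(congr1 fine) /=.
  rewrite charge_integral_mkcond -cint_indic // /L => H.
  apply/eqP; rewrite subr_eq0; apply/eqP.
  transitivity (charge_integral zeta setT (k \_ (B `&` D))).
    congr charge_integral; apply/funext => x; rewrite patchE in_setI !indicE.
    by case: (x \in B); case: (x \in D); rewrite ?mul1r ?mulr1 ?mulr0 ?mul0r.
  rewrite -H; congr charge_integral; apply/funext => x.
  by rewrite indicI.
have Lc c : L (fun=> c) = 0.
  have := LZ c (\1_setT) (bounded_mfun_indic measurableT).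
  rewrite L1 // mulr0 => <-; congr L; apply/funext => x.
  by rewrite indicE in_setT mulr1.
have [_ [K kK]] := hk.
have LB g e : bounded_mfun g -> (forall x, `|g x| <= e) ->
    `|L g| <= e * (`|K| * total_mass zeta + total_mass nu).
  move=> hg ge; rewrite (le_trans (ler_normB _ _)) // mulrDr mulrA lerD //.
    apply: cint_bound => [|x]; first exact: bounded_mfunM.
    by rewrite normrM ler_pM // (le_trans (kK x)) // ler_norm.
  apply: cint_bound => [|x]; first exact: bounded_mfunM.
  rewrite normrM (le_trans _ (ge x)) // ler_piMr //.
  by rewrite indicE; case: (_ \in _); rewrite ?normr1 ?normr0.
apply/eqP; rewrite -subr_eq0 -/(L f) -normr_eq0 eq_le normr_ge0 andbT.
set C := `|K| * total_mass zeta + total_mass nu in LB.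
have C0 : 0 <= C by rewrite addr_ge0 ?mulr_ge0 ?total_mass_ge0.
have C1 : 0 < C + 1 by lra.
apply/ler_addgt0Pr => e e0; rewrite add0r.
have e1 : 0 < e / (C + 1) by rewrite divr_gt0.
have [n [c [B [mB fB]]]] := bounded_mfun_step hf e1.
set r := e / (C + 1) in e1 fB.
have hS : bounded_mfun (fun x => \sum_(0 <= j < n) r * \1_(B j) x).
  by apply: bounded_mfun_sum => j; apply: bounded_mfunZ; exact: bounded_mfun_indic.
have hcS : bounded_mfun (fun x => c + \sum_(0 <= j < n) r * \1_(B j) x).
  by apply: bounded_mfunD => //; exact: bounded_mfun_cst.
have LS : L (fun x => c + \sum_(0 <= j < n) r * \1_(B j) x) = 0.
  rewrite LD //; last exact: bounded_mfun_cst.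
  rewrite Lc add0r; elim: n {fB hS hcS} => [|n IH].
    by rewrite -(Lc 0); congr L; apply/funext => x; rewrite big_geq.
  have hB j := bounded_mfunZ r (bounded_mfun_indic (mB j)).
  under [X in L X]eq_fun do rewrite big_nat_recr //=.
  by rewrite LD ?IH ?LZ ?L1 ?mulr0 ?addr0 //;
    [exact: bounded_mfun_indic | exact: bounded_mfun_sum].
rewrite (_ : L f = L (fun x => f x - (c + \sum_(0 <= j < n) r * \1_(B j) x))).
  rewrite (le_trans (LB _ _ _ fB)) //; first exact: bounded_mfunB.
  by rewrite /r mulrAC -mulrA ler_piMr ?(ltW e0) // ler_pdivrMr // mul1r lerDl.
have := LD f (fun x => -1 * (c + \sum_(0 <= j < n) r * \1_(B j) x)) hf
  (bounded_mfunZ (-1) hcS).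
rewrite LZ // LS mulr0 addr0 => <-; congr L; apply/funext => x.
by rewrite mulN1r.
Qed.

End bounded_integrals.

(** * Finite measures restricted to the integers *)

Section integer_masses.
Variable R : realType.
Local Notation RT := (measurableTypeR R).
Implicit Types (m : {measure set RT -> \bar R}) (z : R).

Lemma measurable_integers : measurable (@integers R : set RT).
Proof.
have -> : @integers R = \bigcup_(n in [set: int]) [set n%:~R].
  by apply/seteqP; split => [_ [n _ <-]|x [n _ ->]]; [exists n|exists n].
by apply: countable_bigcupT_measurable => // n; exact: measurable_set1.
Qed.

Lemma measurable_cosM z : measurable_fun setT (fun x : RT => cos (z * x) : R).
Proof.
apply: continuous_measurable_fun => x; apply: continuous_comp.
  exact: (@mulrl_continuous R z x).
exact: continuous_cos.
Qed.

Lemma measurable_sinM z : measurable_fun setT (fun x : RT => sin (z * x) : R).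
Proof.
apply: continuous_measurable_fun => x; apply: continuous_comp.
  exact: (@mulrl_continuous R z x).
exact: continuous_sin.
Qed.

Lemma norm_cos_le1 (x : R) : `|cos x| <= 1.
Proof. by rewrite ler_norml cos_geN1 cos_le1. Qed.

Lemma norm_sin_le1 (x : R) : `|sin x| <= 1.
Proof. by rewrite ler_norml sin_geN1 sin_le1. Qed.

Lemma bounded_cosM z : bounded_mfun (fun x : RT => cos (z * x) : R).
Proof.
by split; [exact: measurable_cosM | exists 1 => x; exact: norm_cos_le1].
Qed.

Lemma bounded_sinM z : bounded_mfun (fun x : RT => sin (z * x) : R).
Proof.
by split; [exact: measurable_sinM | exists 1 => x; exact: norm_sin_le1].
Qed.

Definition int_mass m (n : int) : R := fine (m [set n%:~R]).

(** The Fourier transform of the restriction of [m] to the integers. *)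
Definition int_transform m z : R[i] :=
  (\int[m]_x (cos (z * x) * \1_(@integers R) x)) +i*
  (\int[m]_x (sin (z * x) * \1_(@integers R) x)).

Lemma int_mass_ge0 m n : 0 <= int_mass m n.
Proof. exact: fine_ge0. Qed.

Section finite.
Variable m : {measure set RT -> \bar R}.
Hypothesis m_fin : (m setT < +oo)%E.

Let bind n : bounded_mfun (\1_[set n%:~R] : RT -> R).
Proof. by apply: bounded_mfun_indic; exact: measurable_set1. Qed.

Lemma int_mass_sums_le : sums_le (int_mass m) (fine (m setT)).
Proof.
move=> s us.
have -> : \sum_(n <- s) int_mass m n = \int[m]_x (\sum_(n <- s) \1_[set n%:~R] x).
  rewrite bint_sum //; apply: eq_bigr => n _.
  by rewrite bint_indic //; exact: measurable_set1.
rewrite -[leRHS]mul1r -Rintegral_cst //; apply: bint_le => //.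
- exact: bounded_mfun_sum.
- exact: bounded_mfun_cst.
move=> x; have [[n nx]|nx] := pselect (exists n : int, x = n%:~R); last first.
  rewrite big1 // => n _; rewrite indicE memNset // => xn.
  by apply: nx; exists n.
have [ns|ns] := boolP (n \in s).
  rewrite (bigD1_seq n) //= big1 ?addr0.
    by rewrite indicE; case: (_ \in _).
  move=> k kn; rewrite indicE memNset //= nx => /intr_inj /eqP.
  by rewrite eq_sym (negbTE kn).
rewrite big_seq big1 // => k ks; rewrite indicE memNset //= nx => /intr_inj nk.
by rewrite nk ks in ns.
Qed.

(** These sets decrease to the empty set, so their masses bound the tails of the
    Fourier series of [m]. *)
Definition far_integers (N : nat) : set RT :=
  @integers R `&` [set x | N%:R < `|x|].

Lemma measurable_far_integers N : measurable (far_integers N).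
Proof.
apply: measurableI; first exact: measurable_integers.
rewrite -[X in measurable X]setTI.
have /(_ measurableT _ (measurable_itv `]N%:R, +oo[)) :
  measurable_fun setT (fun x : RT => `|x| : R) by exact: normr_measurable.
by congr measurable; apply/seteqP; split => y /=; rewrite in_itv /= andbT.
Qed.

Lemma far_integers_cvg0 (e : R) : 0 < e ->
  \forall N \near \oo, fine (m (far_integers N)) <= e.
Proof.
move=> e0.
have cap0 : \bigcap_N far_integers N = set0.
  apply/seteqP; split => // x /(_ (Num.bound `|x|) I) [_ /=].
  by rewrite ltNge (ltW (archi_boundP _)).
have /fine_cvgP [_] : m (far_integers N) @[N --> \oo] --> (0:R)%:E.
  have -> : (0 : R)%:E = m (\bigcap_N far_integers N) by rewrite cap0 measure0.
  apply: nonincreasing_cvg_mu.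
  - by rewrite (le_lt_trans _ m_fin) // le_measure // inE //; exact: measurable_far_integers.
  - exact: measurable_far_integers.
  - by rewrite cap0.
  - move=> a b ab; apply/subsetPset => x [xZ /= bx]; split => //=.
    by rewrite (le_lt_trans _ bx) // ler_nat.
move/cvgrPdist_le => /(_ _ e0); apply: filterS => N /=.
by rewrite sub0r normrN; apply: le_trans; exact: ler_norm.
Qed.

Lemma int_bint_approx (f : RT -> R) N : bounded_mfun f -> (forall x, `|f x| <= 1) ->
  `|\int[m]_x (f x * \1_(@integers R) x) -
    \sum_(n <- int_range N) int_mass m n * f n%:~R| <= fine (m (far_integers N)).
Proof.
move=> hf f1.
have hZ : bounded_mfun (fun x => f x * \1_(@integers R) x).
  apply: bounded_mfunM => //; apply: bounded_mfun_indic; exact: measurable_integers.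
have hS : bounded_mfun (fun x : RT => \sum_(n <- int_range N) f n%:~R * \1_[set n%:~R] x).
  by apply: bounded_mfun_sum => n; exact: bounded_mfunZ.
have -> : \sum_(n <- int_range N) int_mass m n * f n%:~R =
    \int[m]_x (\sum_(n <- int_range N) f n%:~R * \1_[set n%:~R] x).
  rewrite bint_sum //; last by move=> n; exact: bounded_mfunZ.
  apply: eq_bigr => n _; rewrite (bintZ m_fin _ (bind n)) bint_indic.
    exact: mulrC.
  exact: measurable_set1.
rewrite -mulN1r -bintZ // -bintD //; last exact: bounded_mfunZ.
rewrite -bint_indic; last exact: measurable_far_integers.
apply: bint_norm_le => //.
- by apply: bounded_mfunD => //; exact: bounded_mfunZ.
- by apply: bounded_mfun_indic; exact: measurable_far_integers.
move=> x; rewrite mulN1r.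
have [[n nx]|nx] := pselect (exists n : int, x = n%:~R); last first.
  rewrite [\1_(@integers R) x]indicE memNset ?mulr0 ?sub0r; last first.
    by move=> [n _ xn]; apply: nx; exists n.
  rewrite big1 ?oppr0 ?normr0 // => n _; rewrite [\1_[set _] x]indicE memNset ?mulr0 //.
  by move=> xn; apply: nx; exists n.
rewrite [\1_(@integers R) x]indicE mem_set ?mulr1; last by exists n.
have [nN|nN] := leqP `|n| N.
  rewrite (bigD1_seq n) ?mem_int_range ?int_range_uniq //= big1 ?addr0.
    by rewrite [\1_[set _] x]indicE mem_set // mulr1 nx subrr normr0.
  move=> k kn; rewrite [\1_[set _] x]indicE memNset ?mulr0 //= nx => /intr_inj /eqP.
  by rewrite eq_sym (negbTE kn).
rewrite big_seq big1 ?subr0; last first.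
  move=> k; rewrite mem_int_range => kN; rewrite [\1_[set _] x]indicE memNset ?mulr0 //=.
  by rewrite nx => /intr_inj nk; move: kN; rewrite -nk leqNgt nN.
rewrite [\1_(far_integers N) x]indicE mem_set //=.
split; first by exists n.
by rewrite /= nx -intr_norm -[N%:R]/((N%:Z)%:~R) ltr_int; lia.
Qed.

Lemma int_transform_fourier : fourier_series (int_mass m) (int_transform m).
Proof.
move=> e e0; have e2 : 0 < e / 2 by rewrite divr_gt0.
have [N0 _ HN0] := far_integers_cvg0 e2.
exists N0 => N z /HN0 /= mN; rewrite tpoly_eval_trunc.
rewrite (le_trans (cmod_le_ReIm _)) // (splitr e).
have -> : \sum_(n <- int_range N) (int_mass m n)%:C * tone n z =
  (\sum_(n <- int_range N) int_mass m n * cos (z * n%:~R)) +i*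
  (\sum_(n <- int_range N) int_mass m n * sin (z * n%:~R)).
  elim: (int_range N) => [|n s IH]; first by rewrite !big_nil.
  by rewrite !big_cons IH /tone unit_cexpE; simpc.
rewrite /= lerD // (le_trans _ mN) //.
  apply: (@int_bint_approx (fun x => cos (z * x))) => [|x].
    exact: bounded_cosM.
  exact: norm_cos_le1.
apply: (@int_bint_approx (fun x => sin (z * x))) => [|x].
  exact: bounded_sinM.
exact: norm_sin_le1.
Qed.

End finite.

Lemma finite_momentP (h : int -> R) (m : set RT -> \bar R) :
  (forall n, 0 <= h n) -> (forall n : int, (0 <= m [set n%:~R])%E) ->
  (forall n : int, m [set n%:~R] \is a fin_num) ->
  finite_moment h m <->
  exists K, sums_le (fun n => h n * fine (m [set n%:~R])) K.
Proof.
move=> h0 m0 mfin.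
pose a n := h n * fine (m [set n%:~R]).
have aE n : ((h n)%:E * m [set n%:~R])%E = (a n)%:E by rewrite EFinM fineK.
have a0 n : 0 <= a n by rewrite mulr_ge0 // fine_ge0.
rewrite /finite_moment /moment; split.
  move=> mh; exists (fine (\esum_(n in [set: int]) ((h n)%:E * m [set n%:~R])%E)).
  move=> s us; rewrite -lee_fin fineK; last first.
    by rewrite ge0_fin_numE // esum_ge0 // => n _; rewrite aE lee_fin.
  apply: le_ereal_sup_tmp.
  exists (\sum_(n \in [set` s]) ((h n)%:E * m [set n%:~R]))%E.
    by exists [set` s] => //; split => //; exact: finite_seq.
  rewrite -fsbig_seq //; rewrite (eq_bigr (fun n => (a n)%:E)) ?sumEFin //.
move=> [K aK]; apply: (@le_lt_trans _ _ K%:E); last exact: ltry.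
apply: ge_ereal_sup => _ [A [fA _] <-].
rewrite fsbig_finite //= (eq_bigr (fun n => (a n)%:E)); last by move=> n _; rewrite aE.
by rewrite sumEFin lee_fin aK // finmap.fset_uniq.
Qed.

End integer_masses.

Section grs.
Variable R : realType.

(** The two limits bound [h] outside a finite set of integers, which goes into
    the constant. *)
Lemma GRS_subexponential (h : int -> R) (B : R) : 0 < B ->
  (forall n, 0 <= h n) -> GRS_condition h -> subexponential (normalize_weight B h).
Proof.
move=> B0 h0 [Gp Gn] d d0.
have small (u : nat -> \bar R) : u @ \oo --> 0%E ->
    exists N : nat, forall k, (N <= k)%N -> `|fine (u k)| < d.
  move=> /fine_cvgP [_ /cvgrPdist_lt /(_ _ d0) [N _ HN]].
  by exists N => k /HN /=; rewrite sub0r normrN.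
have growth (n : int) : n != 0 -> `|fine (log_ratio h n)| < d ->
    h n <= expR (d * `|n|%N%:R).
  move=> n0; have [hn|hn _] := ltP 0 (h n); last exact: le_trans hn (expR_ge0 _).
  rewrite /log_ratio /= leNgt hn /= normrM normfV.
  have np : 0 < `|n%:~R : R| by rewrite normr_gt0 intr_eq0.
  rewrite ltr_pdivrMr // => /ltW lnh; rewrite -[leLHS]lnK ?posrE // ler_expR.
  rewrite (le_trans (ler_norm _)) // (le_trans lnh) // -intr_norm.
  by rewrite -[`|n|%N%:R]/((`|n|%N%:Z)%:~R) abszE.
have [Np HNp] := small _ Gp; have [Nn HNn] := small _ Gn.
pose N := maxn Np Nn.
have far (n : int) : n != 0 -> (N <= `|n|)%N -> h n <= expR (d * `|n|%N%:R).
  rewrite geq_max => n0 /andP[pn nn]; apply: growth => //.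
  case: (intP n) n0 pn nn => // k _ pn nn.
    by apply: (HNp k.+1).
  by apply: (HNn k.+1); rewrite -abszN opprK in nn.
pose S := \sum_(n <- int_range N) B * h n.
have S0 : 0 <= S by apply: sumr_ge0 => n _; rewrite mulr_ge0 // ltW.
exists (B + 1 + S) => n.
have E1 : 1 <= expR (d * `|n|%N%:R) by rewrite -expR0 ler_expR mulr_ge0 // ltW.
have E0 : 0 <= expR (d * `|n|%N%:R) by exact: expR_ge0.
have C1 : 1 <= (B + 1 + S) * expR (d * `|n|%N%:R).
  by rewrite -[leLHS]mulr1 ler_pM //; lra.
rewrite /normalize_weight; case: eqVneq => // n0; rewrite ge_max C1 andbT.
have [nN|nN] := leqP `|n| N; last first.
  rewrite ler_pM ?(ltW B0) //; first by lra.
  by apply: far => //; exact: ltnW.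
apply: (@le_trans _ _ S).
  rewrite /S (big_rem n) ?mem_int_range //= lerDl sumr_ge0 // => k _.
  by rewrite mulr_ge0 // ltW.
by rewrite -[leLHS]mulr1 ler_pM //; lra.
Qed.

End grs.

(** * The exponent in terms of the quasi-Levy measure *)

Section kernel.
Variable R : realType.
Local Notation RT := (measurableTypeR R).
Implicit Types (x y z : R) (c : R -> R) (nu zeta : {charge set RT -> \bar R}).

Lemma unit_cexp_taylor2 y : cmod (unit_cexp y - 1 - 'i%C * y%:C) <= 10 * y ^+ 2.
Proof.
have iy : cmod ('i%C * y%:C) = `|y|.
  rewrite cmodM cmodR (_ : cmod 'i%C = 1) ?mul1r //.
  by rewrite /cmod /= expr0n expr1n add0r sqrtr1.
have y2 : y ^+ 2 = `|y| ^+ 2 by rewrite real_normK // num_real.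
have y0 := normr_ge0 y.
have [y12|y12] := leP `|y| (1 / 2).
  have := cexp_exp_sum 2 (lexx (cmod ('i%C * y%:C))).
  rewrite iy exp_sum2 opprD addrA => /le_trans; apply.
  apply: le_trans (expR_sub_exp_sum2 _ _) _ => //.
  by rewrite y2 ler_wpM2r ?sqr_ge0 // ler_nat.
(* For [|y| > 1/2] the crude bound [2 + |y|] is at most [10 y^2], which fixes
   the constant. *)
rewrite (le_trans (cmodB _ _)) // iy (le_trans (lerD (cmodB _ _) (lexx _))) //.
rewrite cmod_unit_cexp cmod1 y2; nra.
Qed.

Lemma norm_cos_sub1 y : `|cos y - 1| <= 10 * y ^+ 2.
Proof.
rewrite (le_trans _ (unit_cexp_taylor2 y)) // (le_trans _ (Re_le_cmod _)) //.
by rewrite unit_cexpE; simpc.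
Qed.

Lemma norm_sin_subx y : `|sin y - y| <= 10 * y ^+ 2.
Proof.
rewrite (le_trans _ (unit_cexp_taylor2 y)) // (le_trans _ (Im_le_cmod _)) //.
by rewrite unit_cexpE; simpc.
Qed.

(** The density [1 / (1 /\ x^2)], which the conventions on inverses make 0 at 0. *)
Definition levy_density x : R := (Num.min 1 (x ^+ 2))^-1.

Lemma levy_density0 : levy_density 0 = 0.
Proof. by rewrite /levy_density expr0n /= min_r // invr0. Qed.

Lemma levy_density_ge0 x : 0 <= levy_density x.
Proof. by rewrite invr_ge0 le_min ler01 sqr_ge0. Qed.

Lemma measurable_levy_density : measurable_fun setT (levy_density : RT -> R).
Proof.
(* The inverse is measurable away from 0 as an exponential of a logarithm. *)
have -> : levy_density =
    (fun x => expR (- ln (Num.min 1 (x ^+ 2))) * \1_(~` [set 0]) x).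
  apply/funext => x; have [->|x0] := eqVneq x 0.
    by rewrite levy_density0 indicE memNset ?mulr0 //= => /(_ erefl).
  rewrite indicE mem_set ?mulr1; last exact/eqP.
  by rewrite expRN lnK // posrE lt_min ltr01 exprn_even_gt0.
apply: measurable_funM; last first.
  by apply: measurable_indic; apply: measurableC; exact: measurable_set1.
apply: measurableT_comp; first exact: measurable_expR.
apply: measurable_funN; apply: measurableT_comp; first exact: measurable_ln.
by apply: measurable_minr; [exact: measurable_cst | exact: exprn_measurable].
Qed.

Lemma levy_density_small x : `|x| <= 1 -> x != 0 -> levy_density x = x ^- 2.
Proof.
move=> x1 x0; rewrite /levy_density min_r //.
by rewrite -(real_normK (num_real x)) expr_le1.
Qed.

Lemma levy_density_le (e x : R) : 0 < e -> e <= 1 -> e <= `|x| ->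
  levy_density x <= e ^- 2.
Proof.
move=> e0 e1 ex; rewrite lef_pV2 ?posrE ?exprn_gt0 //; last first.
  rewrite lt_min ltr01 exprn_even_gt0 //= -normr_gt0.
  exact: lt_le_trans ex.
rewrite le_min expr_le1 ?(ltW e0) //= e1 /= -(real_normK (num_real x)).
by rewrite lerXn2r // nnegrE // ltW.
Qed.

Lemma levy_density_le1 x : 1 <= `|x| -> levy_density x <= 1.
Proof. by move=> x1; have := levy_density_le ltr01 (lexx 1) x1; rewrite expr1n invr1. Qed.

Lemma bounded_cos_kernel z :
  bounded_mfun (fun x : RT => (cos (z * x) - 1) * levy_density x).
Proof.
split.
  apply: measurable_funM; last exact: measurable_levy_density.
  by apply: measurable_funB; [exact: measurable_cosM | exact: measurable_cst].
exists (10 * z ^+ 2 + 2) => x; rewrite normrM (ger0_norm (levy_density_ge0 x)).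
have z2 : 0 <= 10 * z ^+ 2 by rewrite mulr_ge0 ?sqr_ge0.
have [->|x0] := eqVneq x 0; first by rewrite levy_density0 mulr0 addr_ge0.
have [x1|/ltW x1] := leP `|x| 1.
  apply: (@le_trans _ _ (10 * z ^+ 2)); last by rewrite lerDl.
  rewrite levy_density_small // ler_pdivrMr ?exprn_even_gt0 //.
  by rewrite -mulrA -exprMn norm_cos_sub1.
apply: (@le_trans _ _ (2 * 1)); last by rewrite mulr1 lerDr.
rewrite ler_pM ?levy_density_ge0 ?levy_density_le1 //.
have := cos_geN1 (z * x); have := cos_le1 (z * x) => ? ?.
by rewrite ler_norml; apply/andP; split; lra.
Qed.

(** Near 0 the representation function is [x + o(x^2)], and the linear terms of
    [sin (z x)] and [z c x] cancel; elsewhere the density is bounded. *)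
Lemma bounded_sin_kernel c z : representation_function c ->
  bounded_mfun (fun x : RT => (sin (z * x) - z * c x) * levy_density x).
Proof.
move=> [mc [M cM] c0]; split.
  apply: measurable_funM; last exact: measurable_levy_density.
  apply: measurable_funB; first exact: measurable_sinM.
  by apply: measurable_funM => //; exact: measurable_cst.
have M0 : 0 <= M := le_trans (normr_ge0 _) (cM 0).
have [d [d0 d1 cd]] : exists d, [/\ 0 < d, d <= 1 & forall x, x != 0 ->
    `|x| < d -> `|c x - x| <= x ^+ 2].
  move/cvgrPdist_le : c0 => /(_ _ ltr01).
  move=> /nbhs_ballP [d /= d0 Hd]; exists (Num.min d 1); split.
  - by rewrite lt_min d0 ltr01.
  - by rewrite ge_min lexx orbT.
  - move=> x x0; rewrite lt_min => /andP[xd _].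
    have := Hd x; rewrite /ball /= sub0r normrN => /(_ xd x0).
    rewrite sub0r normrN normrM normfV (ger0_norm (sqr_ge0 x)).
    by rewrite ler_pdivrMr ?exprn_even_gt0 // mul1r.
pose K1 := 10 * z ^+ 2 + `|z|; pose K2 := (1 + `|z| * M) * d ^- 2.
have K10 : 0 <= K1 by rewrite addr_ge0 // mulr_ge0 ?sqr_ge0.
have K20 : 0 <= K2 by rewrite mulr_ge0 ?addr_ge0 ?mulr_ge0 // invr_ge0 exprn_ge0 // ltW.
exists (K1 + K2) => x; rewrite normrM (ger0_norm (levy_density_ge0 x)).
have [->|x0] := eqVneq x 0; first by rewrite levy_density0 mulr0 addr_ge0.
have [dx|xd] := leP d `|x|.
  apply: (@le_trans _ _ K2); last by rewrite lerDr.
  rewrite ler_pM ?levy_density_ge0 ?levy_density_le //.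
  by rewrite (le_trans (ler_normB _ _)) // normrM lerD ?norm_sin_le1 // ler_wpM2l.
apply: (@le_trans _ _ K1); last by rewrite lerDl.
have x1 : `|x| <= 1 by rewrite ltW // (lt_le_trans xd).
rewrite levy_density_small // ler_pdivrMr ?exprn_even_gt0 //.
have -> : sin (z * x) - z * c x = (sin (z * x) - z * x) - z * (c x - x) by ring.
rewrite (le_trans (ler_normB _ _)) // normrM mulrDl lerD //.
  by rewrite -mulrA -exprMn norm_sin_subx.
by rewrite ler_wpM2l // cd.
Qed.

Lemma Re_gker c x z : complex.Re (gker c x z) =
  (cos (z * x) - 1) * levy_density x - z ^+ 2 / 2 * \1_[set 0] x.
Proof.
rewrite /gker; case: eqVneq => [->|x0].
  by rewrite levy_density0 mulr0 sub0r indicE mem_set // mulr1.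
rewrite indicE memNset ?mulr0 ?subr0; last exact/eqP.
rewrite -fmorphV -[cexp _]/(unit_cexp _) unit_cexpE cReM /= /levy_density.
by ring.
Qed.

Lemma Im_gker c x z : complex.Im (gker c x z) =
  (sin (z * x) - z * c x) * levy_density x.
Proof.
rewrite /gker; case: eqVneq => [->|x0]; first by rewrite levy_density0 mulr0.
rewrite -fmorphV -[cexp _]/(unit_cexp _) unit_cexpE cImM /= /levy_density.
by ring.
Qed.

Definition outside (j : nat) : set RT := [set x | j.+1%:R^-1 <= `|x|].

Lemma measurable_outside j : measurable (outside j).
Proof.
rewrite -[X in measurable X]setTI.
have /(_ measurableT _ (measurable_itv `[j.+1%:R^-1, +oo[)) :
  measurable_fun setT (fun x : RT => `|x| : R) by exact: normr_measurable.
by congr measurable; apply/seteqP; split => y /=; rewrite in_itv /= andbT.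
Qed.

Lemma outside_cvg (f : R -> R) x :
  f x * \1_(outside j) x @[j --> \oo] --> f x * \1_(~` [set 0]) x.
Proof.
apply: cvgM; first exact: cvg_cst.
apply: cvg_near_cst; near=> j; apply/eqP.
have [->|x0] := eqVneq x 0.
  have n1 : ~ outside j 0.
    by rewrite /outside /= normr0; apply/negP; rewrite -ltNge invr_gt0 ltr0n.
  by rewrite !indicE (memNset n1) memNset //= => /(_ erefl).
rewrite !indicE [x \in ~` _]mem_set; last exact/eqP.
rewrite mem_set //.
rewrite /outside /= invf_ple ?posrE ?ltr0n ?normr_gt0 //.
apply: (@le_trans _ _ (Num.bound `|x|^-1)%:R).
  by rewrite ltW // archi_boundP // invr_ge0.
by rewrite ler_nat leqW //; near: j; exact: nbhs_infty_ge.
Unshelve. all: by end_near. Qed.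

(** Away from 0 the measure [nu] has density [levy_density] with respect to
    [zeta]; dominated convergence then fills in a punctured neighbourhood of 0. *)
Lemma quasi_levy_integral nu zeta (f : R -> R) :
  (forall B : set RT, measurable B -> bounded_away_from0 B ->
     nu B = (charge_integral zeta B (fun x => (Num.min 1 (x ^+ 2))^-1))%:E) ->
  bounded_mfun (f : RT -> R) ->
  bounded_mfun (fun x : RT => f x * levy_density x) ->
  charge_integral zeta setT (fun x => f x * levy_density x) =
  charge_integral nu setT (fun x => f x * \1_(~` [set 0]) x).
Proof.
move=> nuE hf hfk.
have m0 : measurable (~` [set 0] : set RT).
  by apply: measurableC; exact: measurable_set1.
have ind1 (A : set RT) x : `|\1_A x : R| <= 1.
  by rewrite indicE; case: (_ \in _); rewrite ?normr1 ?normr0.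
have hO j := @bounded_mfun_indic _ RT R _ (measurable_outside j).
have eqj j : charge_integral zeta setT (fun x => (f x * levy_density x) * \1_(outside j) x) =
    charge_integral nu setT (fun x => f x * \1_(outside j) x).
  have j0 : 0 < j.+1%:R^-1 :> R by rewrite invr_gt0 ltr0n.
  rewrite -(@charge_density _ _ _ nu zeta (outside j) levy_density) //.
  - by congr charge_integral; apply/funext => x; rewrite mulrA.
  - exact: measurable_outside.
  - split.
      apply: measurable_funM; first exact: measurable_levy_density.
      by case: (hO j).
    exists (j.+1%:R^-1 ^- 2) => x; rewrite indicE.
    have [xj|xj] := boolP (x \in outside j); last first.
      by rewrite mulr0 normr0 invr_ge0 exprn_ge0 // ltW.
    rewrite mulr1 ger0_norm ?levy_density_ge0 // levy_density_le //.
      by rewrite invf_le1 ?ltr0n // ler1n.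
    by move: xj; rewrite inE.
  - move=> B mB BD; apply: nuE => //; exists j.+1%:R^-1 => //; exact: BD.
have [mf [K fK]] := hf; have [mfk [L fL]] := hfk.
have cz : charge_integral zeta setT (fun x => (f x * levy_density x) * \1_(outside j) x)
    @[j --> \oo] --> charge_integral zeta setT (fun x => f x * levy_density x).
  apply: (cint_cvg (K := L)) => //.
  - by move=> j; apply: measurable_funM => //; case: (hO j).
  - by move=> j x; rewrite normrM -[leRHS]mulr1 ler_pM.
  - move=> x; have := @outside_cvg (fun x => f x * levy_density x) x.
    have [->|x0] := eqVneq x 0; first by rewrite levy_density0 mulr0 !mul0r.
    by rewrite [\1_(~` _) x]indicE mem_set ?mulr1 //; exact/eqP.
have cn : charge_integral nu setT (fun x => f x * \1_(outside j) x)
    @[j --> \oo] --> charge_integral nu setT (fun x => f x * \1_(~` [set 0]) x).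
  apply: (cint_cvg (K := K)) => //.
  - by move=> j; apply: measurable_funM => //; case: (hO j).
  - by apply: measurable_funM => //; exact: measurable_indic.
  - by move=> j x; rewrite normrM -[leRHS]mulr1 ler_pM.
  - by move=> x; exact: outside_cvg.
rewrite (_ : (fun j => _) = (fun j => charge_integral nu setT
  (fun x => f x * \1_(outside j) x))) in cz; last by apply/funext.
exact: cvg_unique cz cn.
Qed.

End kernel.

(** * Periodicity confines the exponent to the integers *)

Section averaging.
Variable R : realType.
Local Notation RT := (measurableTypeR R).
Implicit Types (x y z : R) (nu : {charge set RT -> \bar R}).

Definition cos_transform nu z : R := charge_integral nu setT (fun x => cos (z * x)).

Definition sin_transform nu z : R := charge_integral nu setT (fun x => sin (z * x)).

Lemma cos_transform_le nu z : `|cos_transform nu z| <= total_mass nu.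
Proof.
rewrite -[leRHS]mul1r; apply: cint_bound; first exact: bounded_cosM.
by move=> x; exact: norm_cos_le1.
Qed.

Lemma sin_transform_le nu z : `|sin_transform nu z| <= total_mass nu.
Proof.
rewrite -[leRHS]mul1r; apply: cint_bound; first exact: bounded_sinM.
by move=> x; exact: norm_sin_le1.
Qed.

Lemma sin_transform_continuous nu : continuous (sin_transform nu).
Proof.
move=> z; apply/(@cvg_nbhsP _ R^o) => u uz.
apply: (cint_cvg (K := 1)).
- by move=> n; exact: measurable_sinM.
- exact: measurable_sinM.
- by move=> n x; exact: norm_sin_le1.
- move=> x; apply: (@cvg_comp _ _ _ (fun n => u n * x) sin _ (nbhs (z * x))).
    by apply: cvgM => //; exact: cvg_cst.
  exact: continuous_sin.
Qed.

(** Between two distinct values an intermediate value would be an integer plus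
    one half. *)
Lemma continuous_int_cst (f : R -> R) : continuous f ->
  (forall z, exists n : int, f z = n%:~R) -> forall y z, f y = f z.
Proof.
move=> cf fZ; suff H y z : y <= z -> f y = f z.
  by move=> y z; case/orP: (le_total y z) => /H.
move=> yz; have [a fy] := fZ y; have [b fz] := fZ z.
have cyz : {within `[y, z], continuous f} by exact: continuous_subspaceT.
have half (k : int) w : f w <> k%:~R + 1 / 2.
  have [n ->] := fZ w => E.
  have : ((n - k) *+ 2)%:~R = 1%:~R :> R by rewrite rmorphMn rmorphB /=; lra.
  by move=> /intr_inj; lia.
have gap (k l : int) : (k < l)%R -> k%:~R + 1 <= l%:~R :> R.
  by move=> kl; rewrite -[1]/(1%:~R) -intrD ler_int; lia.
rewrite fy fz; case: (ltrgtP a b) => [ab|ba|-> //].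
  have [|w _ /half []] := @IVT R f y z (a%:~R + 1 / 2) yz cyz _.
  have := gap _ _ ab; rewrite fy fz => h.
  by rewrite min_l ?max_r; [apply/andP; split| |]; lra.
have [|w _ /half []] := @IVT R f y z (b%:~R + 1 / 2) yz cyz _.
have := gap _ _ ba; rewrite fy fz => h.
by rewrite min_r ?max_l; [apply/andP; split| |]; lra.
Qed.

Lemma bounded_multiples (a K : R) : (forall j : nat, `|a| * j%:R <= K) -> a = 0.
Proof.
move=> H; apply/eqP/negPn/negP => a0; have ap : 0 < `|a| by rewrite normr_gt0.
have K0 : 0 <= K by have := H 0%N; rewrite mulr0.
have := H (Num.bound (K / `|a|)); rewrite leNgt => /negP; apply.
by rewrite mulrC -ltr_pdivrMr // archi_boundP // divr_ge0 // ltW.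
Qed.

(** The averages of the characters [x |-> e^(i (z + 2 pi j) x)] over [j] select
    the integers, where all of them agree. *)
Definition average z (J : nat) x : R[i] :=
  unit_cexp (z * x) * ((J.+1%:R^-1)%:C * \sum_(0 <= j < J.+1) unit_cexp (2 * pi * x) ^+ j).

Lemma averageE z J x : average z J x =
  (J.+1%:R^-1)%:C * \sum_(0 <= j < J.+1) unit_cexp ((z + 2 * pi * j%:R) * x).
Proof.
rewrite /average mulrCA mulr_sumr; congr (_ * _); apply: eq_bigr => j _.
by rewrite -unit_cexp_mulrn -unit_cexpD -mulr_natr; congr unit_cexp; ring.
Qed.

Lemma cmod_average z J x : cmod (average z J x) <= 1.
Proof.
rewrite !cmodM cmod_unit_cexp mul1r cmodR ger0_norm ?invr_ge0 //.
rewrite mulrC ler_pdivrMr ?ltr0n // mul1r (le_trans (cmod_sum _ _ _)) //.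
under eq_bigr do rewrite cmodX cmod_unit_cexp expr1n.
by rewrite big_const_nat subn0 iter_addr_0.
Qed.

Lemma average_cvg z x (e : R) : 0 < e ->
  \forall J \near \oo, cmod (average z J x - (\1_(@integers R) x)%:C * unit_cexp (z * x)) <= e.
Proof.
move=> e0; have [[n _ nx]|xZ] := pselect (@integers R x).
  near=> J; rewrite indicE mem_set; last by exists n.
  rewrite /average -nx unit_cexp_2pi.
  under eq_bigr do rewrite expr1n.
  rewrite big_const_nat subn0 iter_addr_0 -(rmorph_nat (real_complex R)) -rmorphM.
  rewrite mulVf ?pnatr_eq0 // rmorph1 mulr1.
  by rewrite (_ : true%:R%:C = 1) ?mul1r ?subrr ?cmod0 ?ltW //.
have q1 : unit_cexp (2 * pi * x) != 1.
  by apply/eqP => /unit_cexp_2pi_eq1 [n xn]; apply: xZ; exists n.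
set q := unit_cexp (2 * pi * x) in q1.
have q0 : 0 < cmod (q - 1).
  rewrite lt_neqAle cmod_ge0 andbT eq_sym; apply: contra q1 => /eqP.
  by move=> /ComplexField.Normc.eq0_normc /eqP; rewrite subr_eq0.
near=> J; rewrite indicE memNset // mul0r subr0.
rewrite !cmodM cmod_unit_cexp mul1r cmodR ger0_norm ?invr_ge0 // -/q.
rewrite mulrC ler_pdivrMr ?ltr0n //.
have := geometric_sum_le J.+1 (cmod_unit_cexp (2 * pi * x)).
rewrite -/q -ler_pdivlMr // => /le_trans; apply.
rewrite -ler_pdivrMl // (@le_trans _ _ (Num.bound (e^-1 * (2 / cmod (q - 1))))%:R) //.
  by rewrite ltW // archi_boundP // mulr_ge0 ?divr_ge0 ?invr_ge0 ?cmod_ge0 // ltW.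
by rewrite ler_nat leqW //; near: J; exact: nbhs_infty_ge.
Unshelve. all: by end_near. Qed.

Lemma average_Re_cvg z x :
  complex.Re (average z J x) @[J --> \oo] --> cos (z * x) * \1_(@integers R) x.
Proof.
apply/cvgrPdist_le => e e0; have := average_cvg z x e0; apply: filterS => J.
apply: le_trans; rewrite distrC (le_trans _ (Re_le_cmod _)) //.
have E : complex.Re ((\1_(@integers R) x)%:C * unit_cexp (z * x)) =
    cos (z * x) * \1_(@integers R) x.
  by rewrite cReM unit_cexpE /= mul0r subr0 mulrC.
by rewrite [in leRHS]cReD cReN E.
Qed.

Lemma average_Im_cvg z x :
  complex.Im (average z J x) @[J --> \oo] --> sin (z * x) * \1_(@integers R) x.
Proof.
apply/cvgrPdist_le => e e0; have := average_cvg z x e0; apply: filterS => J.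
apply: le_trans; rewrite distrC (le_trans _ (Im_le_cmod _)) //.
have E : complex.Im ((\1_(@integers R) x)%:C * unit_cexp (z * x)) =
    sin (z * x) * \1_(@integers R) x.
  by rewrite cImM unit_cexpE /= mul0r addr0 mulrC.
by rewrite [in leRHS]cImD cImN E.
Qed.

Lemma Re_average z J x : complex.Re (average z J x) =
  J.+1%:R^-1 * \sum_(0 <= j < J.+1) cos ((z + 2 * pi * j%:R) * x).
Proof.
rewrite averageE cReM /= mul0r subr0; congr (_ * _).
elim/big_rec2: _ => [|j a b _ IH] //; by rewrite cReD unit_cexpE IH.
Qed.

Lemma Im_average z J x : complex.Im (average z J x) =
  J.+1%:R^-1 * \sum_(0 <= j < J.+1) sin ((z + 2 * pi * j%:R) * x).
Proof.
rewrite averageE cImM /= mul0r addr0; congr (_ * _).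
elim/big_rec2: _ => [|j a b _ IH] //; by rewrite cImD unit_cexpE IH.
Qed.

(** A periodic transform equals its averages, and these converge to the transform
    of the restriction to the integers. *)
Lemma cos_transform_periodic nu z :
  (forall j : nat, cos_transform nu (z + 2 * pi * j%:R) = cos_transform nu z) ->
  cos_transform nu z =
  charge_integral nu setT (fun x => cos (z * x) * \1_(@integers R) x).
Proof.
move=> per; have cv : charge_integral nu setT (fun x => complex.Re (average z J x))
    @[J --> \oo] --> charge_integral nu setT (fun x => cos (z * x) * \1_(@integers R) x).
  apply: (cint_cvg (K := 1)).
  - move=> J; under eq_fun do rewrite Re_average.
    apply: measurable_funM; first exact: measurable_cst.
    by apply: measurable_sum => j; exact: measurable_cosM.
  - apply: measurable_funM; first exact: measurable_cosM.
    by apply: measurable_indic; exact: measurable_integers.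
  - by move=> J x; rewrite (le_trans (Re_le_cmod _)) // cmod_average.
  - by move=> x; exact: average_Re_cvg.
rewrite (_ : (fun J => _) = (fun=> cos_transform nu z)) in cv.
  exact: cvg_unique (cvg_cst _) cv.
apply/funext => J; under [X in charge_integral _ _ X]eq_fun do rewrite Re_average.
rewrite cintZ; last by apply: bounded_mfun_sum => j; exact: bounded_cosM.
rewrite cint_sum; last by move=> j; exact: bounded_cosM.
under eq_bigr do rewrite -/(cos_transform _ _) per.
rewrite big_const_nat subn0 iter_addr_0 -(mulr_natr (cos_transform nu z)) mulrCA mulVf ?mulr1 //.
Qed.

Lemma sin_transform_periodic nu z :
  (forall j : nat, sin_transform nu (z + 2 * pi * j%:R) = sin_transform nu z) ->
  sin_transform nu z =
  charge_integral nu setT (fun x => sin (z * x) * \1_(@integers R) x).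
Proof.
move=> per; have cv : charge_integral nu setT (fun x => complex.Im (average z J x))
    @[J --> \oo] --> charge_integral nu setT (fun x => sin (z * x) * \1_(@integers R) x).
  apply: (cint_cvg (K := 1)).
  - move=> J; under eq_fun do rewrite Im_average.
    apply: measurable_funM; first exact: measurable_cst.
    by apply: measurable_sum => j; exact: measurable_sinM.
  - apply: measurable_funM; first exact: measurable_sinM.
    by apply: measurable_indic; exact: measurable_integers.
  - by move=> J x; rewrite (le_trans (Im_le_cmod _)) // cmod_average.
  - by move=> x; exact: average_Im_cvg.
rewrite (_ : (fun J => _) = (fun=> sin_transform nu z)) in cv.
  exact: cvg_unique (cvg_cst _) cv.
apply/funext => J; under [X in charge_integral _ _ X]eq_fun do rewrite Im_average.
rewrite cintZ; last by apply: bounded_mfun_sum => j; exact: bounded_sinM.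
rewrite cint_sum; last by move=> j; exact: bounded_sinM.
under eq_bigr do rewrite -/(sin_transform _ _) per.
rewrite big_const_nat subn0 iter_addr_0 -(mulr_natr (sin_transform nu z)) mulrCA mulVf ?mulr1 //.
Qed.

End averaging.

(** * The characteristic function over the integers *)

Section exponent.
Variable R : realType.
Local Notation RT := (measurableTypeR R).
Implicit Types (x z : R).

Lemma charfun_int_transform (mu : probability RT R) z :
  concentrated_on_integers mu -> charfun mu z = int_transform mu z.
Proof.
move=> muZ; have muT : (mu setT < +oo)%E by rewrite probability_setT ltry.
have hZ := @bounded_mfun_indic _ RT R _ (@measurable_integers R).
have mC : measurable (~` (@integers R) : set RT).
  by apply: measurableC; exact: measurable_integers.
have muC : mu (~` (@integers R)) = 0%E.
  by rewrite probability_setC; [rewrite muZ subee | exact: measurable_integers].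
have restrict (f : RT -> R) : bounded_mfun f -> (forall x, `|f x| <= 1) ->
    \int[mu]_x f x = \int[mu]_x (f x * \1_(@integers R) x).
  move=> hf f1; have hfZ := bounded_mfunM hf hZ.
  apply/eqP; rewrite -subr_eq0 -normr_eq0 eq_le normr_ge0 andbT.
  rewrite -mulN1r -bintZ // -bintD //; last exact: bounded_mfunZ.
  have -> : 0 = \int[mu]_x (\1_(~` (@integers R)) x).
    by rewrite bint_indic // [X in fine X]muC.
  apply: bint_norm_le => //.
  - by apply: bounded_mfunD => //; exact: bounded_mfunZ.
  - exact: bounded_mfun_indic.
  move=> x; rewrite !indicE in_setC; case: (_ \in _) => /=.
    by rewrite mulr1 mulN1r subrr normr0.
  by rewrite mulr0 mulr0 addr0.
apply: complex_ext.
- rewrite -[RHS](restrict (fun x => cos (z * x))); last first.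
  - by move=> x; exact: norm_cos_le1.
  - exact: bounded_cosM.
  apply: (congr1 (Rintegral mu setT)); apply/funext => x.
  exact: (congr1 (@complex.Re R) (unit_cexpE (z * x))).
- rewrite -[RHS](restrict (fun x => sin (z * x))); last first.
  - by move=> x; exact: norm_sin_le1.
  - exact: bounded_sinM.
  apply: (congr1 (Rintegral mu setT)); apply/funext => x.
  exact: (congr1 (@complex.Im R) (unit_cexpE (z * x))).
Qed.

Lemma int_transform_periodic (m : {measure set RT -> \bar R}) z (j : nat) :
  int_transform m (z + 2 * pi * j%:R) = int_transform m z.
Proof.
have per x : @integers R x -> unit_cexp ((z + 2 * pi * j%:R) * x) = unit_cexp (z * x).
  move=> [n _ <-]; rewrite mulrDl unit_cexpD.
  have -> : 2 * pi * j%:R * n%:~R = 2 * pi * (j%:Z * n)%:~R :> R.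
    by rewrite intrM mulrA.
  by rewrite unit_cexp_2pi mulr1.
congr (_ +i* _); congr Rintegral; apply/funext => x; rewrite indicE;
  have [xZ|_] := boolP (x \in _); rewrite ?mulr0 // !mulr1;
  by have := per x (set_mem xZ); rewrite !unit_cexpE => -[].
Qed.

Lemma cexp_inj_mod (v w : R[i]) : cexp v = cexp w ->
  complex.Re v = complex.Re w /\
  exists k : int, complex.Im v = complex.Im w + 2 * pi * k%:~R.
Proof.
move=> vw; have Re_eq : complex.Re v = complex.Re w.
  by apply: expR_inj; rewrite -!cmod_cexp vw.
split=> //.
have pi2 : 2 * pi != 0 :> R by rewrite mulf_neq0 ?gt_eqF ?pi_gt0.
have [|k kE] := @unit_cexp_2pi_eq1 R ((complex.Im v - complex.Im w) / (2 * pi)).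
  rewrite mulrC divfK //.
  have E0 : expR (complex.Re w) != 0 by rewrite gt_eqF // expR_gt0.
  have uvw : unit_cexp (complex.Im v) = unit_cexp (complex.Im w).
    rewrite !unit_cexpE; move: vw; rewrite /cexp Re_eq => -[cE sE].
    by rewrite (mulfI E0 cE) (mulfI E0 sE).
  by rewrite unit_cexpD uvw -unit_cexpD subrr unit_cexp0.
by exists k; rewrite -kE mulrC divfK // addrC subrK.
Qed.

Section levy_khintchine.
Variables (c : R -> R) (mu : probability RT R) (nu zeta : {charge set RT -> \bar R}).
Variable gamma : R.
Hypotheses (hc : representation_function c) (muZ : concentrated_on_integers mu).
Hypothesis hchar : characteristic_pair c mu zeta gamma.
Hypothesis nuE : forall B : set RT, measurable B -> bounded_away_from0 B ->
  nu B = (charge_integral zeta B (fun x => (Num.min 1 (x ^+ 2))^-1))%:E.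

(** The Gaussian coefficient and the drift left after the compensating term has
    been integrated against [nu]. *)
Let sigma : R := fine (zeta [set 0]).
Let drift : R := gamma - charge_integral nu setT (fun x => c x * \1_(~` [set 0]) x).
Let V := total_mass nu.

Let exponent z : R[i] :=
  'i%C * (gamma * z)%:C + charge_cintegral zeta (fun x => gker c x z).

Let hN0 : bounded_mfun (\1_(~` [set 0]) : RT -> R).
Proof.
by apply: bounded_mfun_indic; apply: measurableC; exact: measurable_set1.
Qed.

Let Re_exponent z : complex.Re (exponent z) =
  cos_transform nu z - cos_transform nu 0 - z ^+ 2 / 2 * sigma.
Proof.
rewrite /exponent cReD cReM /= !(mul0r, mulr0, subr0, oppr0, add0r).
have h0 : bounded_mfun (\1_[set 0] : RT -> R).
  by apply: bounded_mfun_indic; exact: measurable_set1.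
have hcos := bounded_mfunB (bounded_cosM z) (@bounded_mfun_cst _ RT R 1).
under [X in charge_integral _ _ X]eq_fun do rewrite Re_gker.
rewrite cintB; [|exact: bounded_cos_kernel|exact: bounded_mfunZ].
rewrite cintZ // cint_indic; last exact: measurable_set1.
congr (_ - _); rewrite (quasi_levy_integral nuE) //; last exact: bounded_cos_kernel.
rewrite /cos_transform -cintB; [|exact: bounded_cosM|exact: bounded_cosM].
congr charge_integral; apply/funext => x; rewrite mul0r cos0.
have [->|x0] := eqVneq x 0; first by rewrite mulr0 cos0 subrr mul0r.
by rewrite indicE mem_set ?mulr1 //; exact/eqP.
Qed.

Let Im_exponent z : complex.Im (exponent z) = drift * z + sin_transform nu z.
Proof.
rewrite /exponent cImD cImM /= !(mul0r, mul1r, add0r).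
have hcf : bounded_mfun (c : RT -> R) by case: hc => mc [M cM] _; split => //; exists M.
have hzc := bounded_mfunZ z hcf.
have hsin := bounded_sinM z.
under [X in charge_integral _ _ X]eq_fun do rewrite Im_gker.
rewrite (@quasi_levy_integral _ nu) //; [|exact: bounded_mfunB|exact: bounded_sin_kernel].
rewrite /drift mulrBl -addrA; congr (_ + _).
have -> : (fun x => (sin (z * x) - z * c x) * \1_(~` [set 0]) x) =
    (fun x => sin (z * x) - z * (c x * \1_(~` [set 0]) x)).
  apply/funext => x; rewrite mulrBl mulrA; congr (_ - _).
  have [->|x0] := eqVneq x 0; first by rewrite mulr0 sin0 mul0r.
  by rewrite indicE mem_set ?mulr1 //; exact/eqP.
have hcN := bounded_mfunM hcf hN0.
by rewrite cintB ?cintZ //; [rewrite addrC mulrC | exact: bounded_mfunZ].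
Qed.

Let exponentE z : int_transform mu z = cexp (exponent z).
Proof. by rewrite -charfun_int_transform // hchar. Qed.

Let jump z (j : nat) := cexp_inj_mod (etrans (esym (exponentE (z + 2 * pi * j%:R)))
  (etrans (int_transform_periodic mu z j) (exponentE z))).

(** A Gaussian part would drive the modulus of the transform to 0 or to infinity
    along the multiples of [2 pi], where it is 1. *)
Let sigma0 : sigma = 0.
Proof.
apply: (@bounded_multiples R sigma (V + V)) => j.
have [+ _] := jump 0 j; rewrite !Re_exponent add0r expr0n /= !mul0r.
have := cos_transform_le nu (2 * pi * j%:R); have := cos_transform_le nu 0.
rewrite -/V; set a := cos_transform _ _; set b := cos_transform _ _ => ha hb E.
have {}E : (2 * pi * j%:R) ^+ 2 / 2 * sigma = b - a by lra.
have : `|(2 * pi * j%:R) ^+ 2 / 2 * sigma| <= V + V.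
  by rewrite E (le_trans (ler_normB _ _)) // lerD.
apply: le_trans; rewrite normrM mulrC ler_wpM2r //.
have p2 : 2 <= pi :> R by exact: pi_ge2.
have jj : j%:R <= j%:R ^+ 2 :> R.
  by rewrite -natrX ler_nat; case: (j) => // k; rewrite -mulnn leq_pmulr.
have pp : 4 <= pi ^+ 2 :> R by nra.
rewrite ger0_norm ?divr_ge0 ?sqr_ge0 // !exprMn.
have j0 : 0 <= j%:R :> R by [].
nra.
Qed.

Let cos_periodic z (j : nat) :
  cos_transform nu (z + 2 * pi * j%:R) = cos_transform nu z.
Proof.
by have [+ _] := jump z j; rewrite !Re_exponent sigma0 !mulr0 !subr0 => /addIr.
Qed.

(** The increment of the exponent over a period is continuous and takes its values
    in a discrete set; its constant value is read off by iterating it. *)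
Let sin_periodic :
  exists2 k : int, drift = k%:~R &
  forall z (j : nat), sin_transform nu (z + 2 * pi * j%:R) = sin_transform nu z.
Proof.
have pi2 : 2 * pi != 0 :> R by rewrite mulf_neq0 ?gt_eqF ?pi_gt0.
pose f z := drift + (sin_transform nu (z + 2 * pi) - sin_transform nu z) / (2 * pi).
have fZ z : exists k : int, f z = k%:~R.
  have [_ [k kE]] := jump z 1%N; exists k; move: kE; rewrite !Im_exponent mulr1 => kE.
  apply: (mulfI pi2); rewrite /f mulrDr [_ * (_ / _)]mulrC divfK //; lra.
have cf : continuous f.
  move=> z; apply: cvgD; first exact: cvg_cst.
  apply: cvgM; last exact: cvg_cst.
  apply: cvgB; last exact: sin_transform_continuous.
  apply: (@cvg_comp _ _ _ (fun z => z + 2 * pi) (sin_transform nu) _ (nbhs (z + 2 * pi))).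
    by apply: cvgD; [exact: cvg_id | exact: cvg_cst].
  exact: sin_transform_continuous.
have [k fk] := fZ 0.
pose a := 2 * pi * (k%:~R - drift).
have step z : sin_transform nu (z + 2 * pi) = sin_transform nu z + a.
  have := continuous_int_cst cf fZ z 0; rewrite fk /f /a => /(congr1 (fun x => 2 * pi * x)).
  by rewrite mulrDr [_ * (_ / _)]mulrC divfK // => H; rewrite mulrBr -H; ring.
have steps z (j : nat) : sin_transform nu (z + 2 * pi * j%:R) = sin_transform nu z + a * j%:R.
  elim: j => [|j IH]; first by rewrite !mulr0 !addr0.
  have -> : z + 2 * pi * j.+1%:R = (z + 2 * pi * j%:R) + 2 * pi.
    by rewrite -natr1; ring.
  by rewrite step IH -natr1; ring.
have a0 : a = 0.
  apply: (@bounded_multiples R a (V + V)) => j.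
  have -> : `|a| * j%:R = `|sin_transform nu (0 + 2 * pi * j%:R) - sin_transform nu 0|.
    by rewrite steps addrAC subrr add0r [in RHS]normrM normr_nat.
  by rewrite (le_trans (ler_normB _ _)) // lerD // sin_transform_le.
exists k; last by move=> z j; rewrite steps a0 mul0r addr0.
by move: a0 => /eqP; rewrite mulf_eq0 (negbTE pi2) /= subr_eq0 eq_sym => /eqP.
Qed.

(** The drift has become the frequency [k], and the value of the exponent of [nu]
    at 0 the constant [C]. *)
Lemma int_transform_exp : exists (k : int) (C : R), 0 < C /\ forall z,
  int_transform mu z = C%:C * tone k z *
    cexp (int_transform (jordan_pos_part nu) z - int_transform (jordan_neg_part nu) z).
Proof.
have [k driftE sper] := sin_periodic.
exists k, (expR (- cos_transform nu 0)); split=> [|z]; first exact: expR_gt0.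
rewrite exponentE.
have -> : (expR (- cos_transform nu 0))%:C = cexp (- cos_transform nu 0)%:C.
  by rewrite /cexp /= cos0 sin0 mulr1 mulr0.
rewrite -!cexpD; congr cexp; apply: complex_ext.
- rewrite Re_exponent sigma0 mulr0 subr0 cReD /= !(mul0r, mulr0, subr0, addr0).
  rewrite (cos_transform_periodic (cos_periodic z)) addrC; congr (_ + _).
- rewrite Im_exponent driftE cImD /= !(mul0r, mul1r, add0r) [z * _]mulrC.
  by rewrite (sin_transform_periodic (sper z)).
Qed.

End levy_khintchine.

End exponent.

(** * Equivalence of the three moments *)

Section jordan_masses.
Variable R : realType.
Variable nu : {charge set (measurableTypeR R) -> \bar R}.

(** A point lies in only one of the two sets of a Hahn decomposition. *)
Lemma jordan_pos_or_neg0 (x : R) :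
  jordan_pos_part nu [set x] = 0%E \/ jordan_neg_part nu [set x] = 0%E.
Proof.
have [_ _ _ PN] := hahnP nu.
have mx : measurable ([set x] : set (measurableTypeR R)) by exact: measurable_set1.
have [xP|xP] := pselect (hahn_pos nu x).
  right; rewrite -[LHS]/(jordan_neg (hahnP nu) [set x]) jordan_negE cjordan_negE /crestr0 mem_set //.
  rewrite /crestr (_ : [set x] `&` _ = set0) ?charge0 ?oppe0 //.
  apply/seteqP; split => // y [/= -> xN].
  have : (hahn_pos nu `&` hahn_neg nu) x by [].
  by rewrite PN.
left; rewrite -[LHS]/(jordan_pos (hahnP nu) [set x]) jordan_posE cjordan_posE /crestr0 mem_set //.
rewrite /crestr (_ : [set x] `&` _ = set0) ?charge0 //.
by apply/seteqP; split => // y [/= ->].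
Qed.

(** Thus the Jordan decomposition can be read off point by point, which turns
    absolute summability of the coefficients of [nu^] into a moment of [|nu|]. *)
Lemma int_mass_jordan_normB (n : int) :
  `|int_mass (jordan_pos_part nu) n - int_mass (jordan_neg_part nu) n| =
  int_mass (jordan_pos_part nu) n + int_mass (jordan_neg_part nu) n.
Proof.
rewrite /int_mass; case: (jordan_pos_or_neg0 n%:~R) => -> /=.
  by rewrite sub0r normrN add0r ger0_norm // fine_ge0.
by rewrite subr0 addr0 ger0_norm // fine_ge0.
Qed.

Lemma charge_total_variation_fineE (n : int) :
  fine (charge_total_variation nu [set n%:~R]) =
  int_mass (jordan_pos_part nu) n + int_mass (jordan_neg_part nu) n.
Proof.
rewrite /int_mass -fineD //.
- by apply: jordan_pos_part_fin; exact: measurable_set1.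
- by apply: jordan_neg_part_fin; exact: measurable_set1.
Qed.

End jordan_masses.

Local Close Scope complex_scope.
Local Close Scope classical_set_scope.

Theorem theorem8p10 (R : realType)
  (c : R -> R) (hc : representation_function c)
  (mu : probability (measurableTypeR R) R)
  (hmuZ : concentrated_on_integers mu)
  (hmu : quasi_infinitely_divisible c mu)
  (nu : {charge set (measurableTypeR R) -> \bar R})
  (hnu : quasi_levy_measure c mu nu)
  (h : int -> R) (h_ge0 : forall n : int, 0 <= h n)
  (h_sub : submultiplicative h) (h_GRS : GRS_condition h) :
  (finite_moment h mu <-> finite_moment h (jordan_pos_part nu)) /\
  (finite_moment h (jordan_pos_part nu) <-> finite_moment h (charge_total_variation nu)).
Proof.
have [gamma [zeta [hchar _ nuE]]] := hnu.
have [k [C [C0 muE]]] := int_transform_exp hc hmuZ hchar nuE.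
have [B B0 hB] := h_sub.
set H := normalize_weight B h.
have hH : weight H by exact: normalize_weightP.
have gH : subexponential H by exact: GRS_subexponential.
set p := jordan_pos_part nu in muE *; set q := jordan_neg_part nu in muE *.
have m1 (n : int) : measurable ([set n%:~R]%classic : set (measurableTypeR R)).
  exact: measurable_set1.
have mu_lty : (mu setT < +oo)%E by rewrite probability_setT ltry.
have p_lty : (p setT < +oo)%E by exact: jordan_pos_part_lty.
have q_lty : (q setT < +oo)%E by exact: jordan_neg_part_lty.
pose A := fine (mu setT) + fine (p setT) + fine (q setT).
have [a0 b0 c0] : [/\ 0 <= fine (mu setT), 0 <= fine (p setT) & 0 <= fine (q setT)].
  by split; rewrite fine_ge0.
have muA : sums_le (int_mass mu) A.
  by apply: sums_le_mono (int_mass_sums_le mu_lty) => //; rewrite /A; lra.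
have pA : sums_le (int_mass p) A.
  by apply: sums_le_mono (int_mass_sums_le p_lty) => //; rewrite /A; lra.
have qA : sums_le (int_mass q) A.
  by apply: sums_le_mono (int_mass_sums_le q_lty) => //; rewrite /A; lra.
have pqA : sums_le (fun n => int_mass p n + int_mass q n) (A + A) by exact: sums_leD.
have pq0 n : 0 <= int_mass p n + int_mass q n by rewrite addr_ge0 ?int_mass_ge0.
have norm_moment (m : int -> R) K : (forall n, 0 <= m n) -> sums_le m K ->
    (exists L, sums_le (fun n => h n * m n) L) <->
    (exists L, sums_le (fun n => H n * m n) L).
  exact: normalize_weight_sums.
have mom_mu : finite_moment h mu <-> exists K, sums_le (fun n => H n * int_mass mu n) K.
  rewrite -(norm_moment _ _ (int_mass_ge0 mu) muA); apply: finite_momentP => // n.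
  exact: fin_num_measure.
have mom_p : finite_moment h p <-> exists K, sums_le (fun n => H n * int_mass p n) K.
  rewrite -(norm_moment _ _ (int_mass_ge0 p) pA); apply: finite_momentP => // n.
  exact: jordan_pos_part_fin.
have mom_pq : finite_moment h (charge_total_variation nu) <->
    exists K, sums_le (fun n => H n * (int_mass p n + int_mass q n)) K.
  rewrite -(norm_moment _ _ pq0 pqA).
  rewrite (_ : (fun n => _ * _) =
    (fun n : int => h n * fine (charge_total_variation nu [set n%:~R]%classic))).
    apply: finite_momentP => // n; rewrite -[charge_total_variation _ _]/(p _ + q _)%E.
    by rewrite fin_numD; apply/andP; split;
      [exact: jordan_pos_part_fin | exact: jordan_neg_part_fin].
  by apply/funext => n; rewrite charge_total_variation_fineE.
have i_iii : finite_moment h mu -> finite_moment h (charge_total_variation nu).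
  rewrite mom_mu mom_pq; apply: (total_variation_moment hH C0 (int_mass_ge0 mu) pA qA
    (int_transform_fourier mu_lty) (int_transform_fourier p_lty)
    (int_transform_fourier q_lty) muE gH); exact: int_mass_jordan_normB.
have iii_ii : finite_moment h (charge_total_variation nu) -> finite_moment h p.
  rewrite mom_pq mom_p => -[K hK]; exists K.
  apply: (sums_le_mono _ (lexx _) hK) => n.
  by rewrite ler_wpM2l ?(weight_ge0 _ hH) // lerDl int_mass_ge0.
have ii_i : finite_moment h p -> finite_moment h mu.
  rewrite mom_p mom_mu; exact: (moment_of_pos_part hH (int_mass_ge0 mu)
    (int_mass_ge0 p) (int_mass_ge0 q) muA qA (int_transform_fourier mu_lty)
    (int_transform_fourier p_lty) (int_transform_fourier q_lty) muE).
split; split.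
- by move/i_iii/iii_ii.
- exact: ii_i.
- by move/ii_i/i_iii.
- exact: iii_ii.
Qed.
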